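(* Let $(\Omega,\mathcal{F},\mathbb{P})$, the shifts $\{\vartheta_t;t\in\mathbb{R}\}$, the point process $N$ with points $\{t_n;n\in\mathbb{Z}\}$, $T_n=t_n-t_{n-1}$, $R(\cdot)$, $\widetilde\lambda^{(v)}(\cdot)$ and the probability measure $\overline{\mathbb{P}}$ be as described in the context, where $\mathbb{P}$ is the Palm distribution, under which $t_0=0$ almost surely, $T_n>0$ almost surely and $\mathbb{E}[T_n]<\infty$. Write $N(t)=N([0,t])$ for $t\ge0$ and assume $\mathbb{E}[N(t)]<\infty$ for all finite $t\ge0$. Suppose that (i) $\{T_n;n\in\mathbb{Z}\}$ is a stationary and ergodic sequence under $\mathbb{P}$; (ii) for some $v>0$, the family $\{\widetilde\lambda^{(v)}(t);t\ge0\}$ is uniformly integrable under $\mathbb{P}$; (iii) for all $A\in\mathcal{F}$ and $u\ge0$, $$\lim_{t\to\infty}\overline{\mathbb{P}}\big(\{\omega:\vartheta_t(\omega)\in A\}\cap\{t_1\le u\}\big)=\overline{\mathbb{P}}(A)\,\overline{\mathbb{P}}(t_1\le u).$$ Then, with $\lambda=1/\mathbb{E}[T_1]$, $$\lim_{t\to\infty}\frac{\mathbb{E}[N(t)]}{t}=\lambda,\qquad \lim_{t\to\infty}\big(\mathbb{E}[N(t+h)]-\mathbb{E}[N(t)]\big)=\lambda h\quad\text{for every }0<h<\infty,$$ and $$\lambda=\frac1{\mathbb{E}[T_1]}=\overline{\mathbb{E}}\Big[\widetilde\lambda^{(v)}(0)\,1\big(R(0)\le v\big)\Big],\qquad v>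0.$$
   Context: Setting. $(\Omega,\mathcal{F})$ is a measurable space carrying a (jointly measurable) group $\{\vartheta_t;t\in\mathbb{R}\}$ of shifts $\vartheta_t:\Omega\to\Omega$ and a simple point process $N$ on $\mathbb{R}$ with $N(B)(\vartheta_t\omega)=N(B+t)(\omega)$ for all bounded Borel $B\subset\mathbb{R}$, $t\in\mathbb{R}$, where $B+t=\{x+t:x\in B\}$. The points of $N$ are enumerated as $\cdots<t_{-1}<t_0\le0<t_1<t_2<\cdots$, so $N(B)=\sum_{n\in\mathbb{Z}}1(t_n\in B)$, and $T_n=t_n-t_{n-1}$, $n\in\mathbb{Z}$. The probability measure $\mathbb{P}$ (the Palm distribution) on $(\Omega,\mathcal{F})$ satisfies $\mathbb{P}(t_0=0)=1$ and $\mathbb{P}(\{\omega:\vartheta_{t_n(\omega)}(\omega)\in A\})=\mathbb{P}(A)$ for all $A\in\mathcal{F}$, $n\in\mathbb{Z}$. $\mathbb{E}$ denotes expectation under $\mathbb{P}$, and $\lambda=1/\mathbb{E}[T_1]$. The probability measure $\overline{\mathbb{P}}$ on $(\Omega,\mathcal{F})$ (under which $N$ is a stationary point process) is $$\overline{\mathbb{P}}(A)=\lambda\,\mathbb{E}\Big[\int_0^{T_1}1_A(\vartheta_t\omega)\,dt\Big],\qquad A\in\mathcal{F},$$ and $\overline{\mathbb{E}}$ is the corresponding expectation. The residual time process is $R(t)=t_n-t$ for $t\in[t_{n-1},t_n)$, $n\in\mathbb{Z}$. The filtration is $\mathcal{F}_t=\sigma\big(\{R(u);u\le t\}\cup\bigcup_{n\in\mathbb{Z}}\{t_n\le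 t\}\big)$, $t\in\mathbb{R}$, and for a stopping time $\tau$, $\mathcal{F}_{\tau-}=\sigma(\{A\cap\{t<\tau\};A\in\mathcal{F}_t,t\in\mathbb{R}\})$. For $v>0$ let $T_n^{(v)}=T_n\wedge v$ and $$\widetilde\lambda^{(v)}(t)=\frac1{\mathbb{E}[T_n^{(v)}\mid\mathcal{F}_{t_{n-1}-}]},\qquad t\in[t_{n-1},t_n),\ n\in\mathbb{Z}.$$ Here the conditional expectation is taken under $\mathbb{P}$. Conditioning on $\mathcal{F}_{t_{n-1}-}$ amounts under $\mathbb{P}$ to conditioning on $(T_k)_{k\le n-1}$, and by stationarity one uses a single measurable version: $\mathbb{E}[T_n^{(v)}\mid\mathcal{F}_{t_{n-1}-}]=g_v(T_{n-1},T_{n-2},\ldots)$ for all $n$, where $g_v$ is a measurable function, with values in $(0,v]$, such that $g_v(T_0,T_{-1},\ldots)=\mathbb{E}[T_1^{(v)}\mid T_0,T_{-1},\ldots]$ $\mathbb{P}$-a.s. Thus $\widetilde\lambda^{(v)}(t)=1/g_v(T_{n-1},T_{n-2},\ldots)$ on $[t_{n-1},t_n)$ is defined on $\Omega$ and can be considered under both $\mathbb{P}$ and $\overline{\mathbb{P}}$ (in particular $\widetilde\lambda^{(v)}(0)=1/g_v(T_0,T_{-1},\ldots)$). *)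

(* Defs.v *)
From HB Require Import structures.
From mathcomp Require Import all_boot all_order all_algebra.
From mathcomp Require Import all_classical all_reals all_analysis.
Set Implicit Arguments.
Unset Strict Implicit.
Unset Printing Implicit Defensive.
Import Order.TTheory GRing.Theory Num.Theory.
Import numFieldNormedType.Exports.
Local Open Scope classical_set_scope.
Local Open Scope ring_scope.

(* Generators of the product sigma-algebra on the sequence space I -> R. *)
Definition cylinders (I : Type) (R : realType) : set (set (I -> R)) :=
  [set C | exists i (B : set R), measurable B /\ C = [set x | B (x i)]].

Section Probability.
Context {d : measure_display} {Omega : measurableType d} {R : realType}.
Variable P : probability Omega R.

(* Y is a version of the conditional expectation of X given the
   sub-sigma-algebra G. *)
Definition cond_exp_version (G : set (set Omega)) (X Y : Omega -> R) : Prop :=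
  [/\ forall B : set R, measurable B -> G (Y @^-1` B),
      P.-integrable setT (EFin \o Y)
    & forall A, G A -> (\int[P]_(w in A) (Y w)%:E = \int[P]_(w in A) (X w)%:E)%E].

Definition uniformly_integrable (I : Type) (D : set I) (X : I -> Omega -> R) :
    Prop :=
  (forall i, D i -> P.-integrable setT (EFin \o X i)) /\
  forall eps : R, 0 < eps -> exists K : R, forall i, D i ->
    (\int[P]_(w in [set w | (K < `|X i w|)%R]) (`|X i w|)%:E <= eps%:E)%E.

Definition stationary_sequence (X : int -> Omega -> R) : Prop :=
  forall (m : int) (A : set (int -> R)), <<s @cylinders int R >> A ->
    P [set w | A (fun n => X (n + m) w)] = P [set w | A (fun n => X n w)].

Definition ergodic_sequence (X : int -> Omega -> R) : Prop :=
  forall A : set (int -> R), <<s @cylinders int R >> A ->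
    [set x : int -> R | A (fun n => x (n + 1))] = A ->
    P [set w | A (fun n => X n w)] = 0%E \/ P [set w | A (fun n => X n w)] = 1%E.

End Probability.

Section PointProcess.
Context {d : measure_display} {Omega : measurableType d} {R : realType}.

Definition measurable_flow (theta : R -> Omega -> Omega) : Prop :=
  [/\ measurable_fun setT (fun p : R * Omega => theta p.1 p.2),
      forall w, theta 0 w = w
    & forall s t w, theta (s + t) w = theta s (theta t w)].

Variable pt : int -> Omega -> R.

Definition point_count (B : set R) (w : Omega) : \bar R :=
  (\esum_(n in [set: int]) (\1_B (pt n w))%:E)%E.

(* The simple point process is given by its enumerated points; strict
   monotonicity is its simplicity. *)
Definition simple_point_process : Prop :=
  [/\ forall n, measurable_fun setT (pt n),
      forall n w, pt n w < pt (n + 1) w,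
      forall w, pt 0 w <= 0 /\ 0 < pt 1 w
    & forall (B : set R) w, measurable B -> bounded_set B ->
        (point_count B w < +oo)%E].

Definition shift_compatible (theta : R -> Omega -> Omega) : Prop :=
  forall (B : set R) (t : R) (w : Omega), measurable B -> bounded_set B ->
    point_count B (theta t w) = point_count [set x + t | x in B] w.

Definition gap (n : int) (w : Omega) : R := pt n w - pt (n - 1) w.

(* The sequence (gap n, gap (n-1), gap (n-2), ...). *)
Definition past_gaps (n : int) (w : Omega) : nat -> R :=
  fun k => gap (n - k%:Z) w.

(* The n with pt (n-1) <= t < pt n, which is unique for a simple point process
   with infinitely many points on both sides; the default 0 is never used. *)
Definition interval_index (t : R) (w : Omega) : int :=
  xget 0 [set n : int | pt (n - 1) w <= t /\ t < pt n w].

Definition residual_time (t : R) (w : Omega) : R :=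
  pt (interval_index t w) w - t.

Definition filtration (t : R) : set (set Omega) :=
  <<s [set A | (exists (u : R) (B : set R),
                  [/\ u <= t, measurable B & A = residual_time u @^-1` B])
            \/ (exists n : int, A = [set w | pt n w <= t])] >>.

Definition strict_past (tau : Omega -> R) : set (set Omega) :=
  <<s [set C | exists (t : R) (A : set Omega),
                 filtration t A /\ C = A `&` [set w | t < tau w]] >>.

Definition gap_past_sigma (n : int) : set (set Omega) :=
  <<s [set A | exists (k : nat) (B : set R),
                 measurable B /\ A = gap (n - k%:Z) @^-1` B] >>.

(* gv is a single version, common to all indices, of the conditional
   expectation of the truncated gap.  Conditioning on strict_past (pt (n - 1))
   is required for 1 <= n only: for n <= 0, since pt 0 = 0 almost surely under
   the Palm distribution, the position of pt (n - 1) also reveals the sum of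
   the gaps n, ..., 0. *)
Definition truncated_mean_version (P : probability Omega R) (v : R)
    (gv : (nat -> R) -> R) : Prop :=
  [/\ measurable_fun setT (gv : g_sigma_algebraType (@cylinders nat R) -> R),
      forall x, 0 < gv x /\ gv x <= v,
      cond_exp_version P (gap_past_sigma 0)
        (fun w => Num.min (gap 1 w) v) (fun w => gv (past_gaps 0 w))
    & forall n : int, 1 <= n ->
        cond_exp_version P (strict_past (pt (n - 1)))
          (fun w => Num.min (gap n w) v) (fun w => gv (past_gaps (n - 1) w))].

Definition lambda_tilde (gv : (nat -> R) -> R) (t : R) (w : Omega) : R :=
  (gv (past_gaps (interval_index t w - 1) w))^-1.

Definition palm_distribution (theta : R -> Omega -> Omega)
    (P : probability Omega R) : Prop :=
  P [set w | pt 0 w = 0] = 1%E /\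
  forall (n : int) (A : set Omega), measurable A ->
    P [set w | A (theta (pt n w) w)] = P A.

Definition intensity (P : probability Omega R) : R := (fine 'E_P[gap 1])^-1.

Definition stationary_distribution (theta : R -> Omega -> Omega)
    (P Pbar : probability Omega R) : Prop :=
  forall A : set Omega, measurable A ->
    (Pbar A = (intensity P)%:E *
      \int[P]_w \int[lebesgue_measure]_(t in `[0%R, gap 1 w])
                   (\1_A (theta t w))%:E)%E.

Definition mean_count (P : probability Omega R) (t : R) : \bar R :=
  (\int[P]_w point_count `[0%R, t] w)%E.

End PointProcess.

(* Main.v *)
(* Write T_n for the gaps and Lam(s) for lambda_tilde gv s.  Each gap ratio
   min(T_(n+1), v) / E[min(T_(n+1), v) | past] has conditional mean one, so the
   mean number of points in an interval equals the mean of the sum of the gap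
   ratios over these points.  Spreading each ratio uniformly over the first
   min(T_(n+1), delta) units of time after its point turns this sum into
   \int Lam(s) b(theta_s) ds with a bounded factor b, up to a displacement
   smaller than delta.  Over one Palm cycle this density integrates to the gap
   ratio, so its stationary mean is the intensity; the formula for the
   intensity in the theorem is the same computation with the weight
   1(R(0) <= v).

   It remains to see that time averages of P(theta_s in A) over [a, a + h]
   converge to Pbar(A).  By Palm invariance, Pbar(theta_t in A, t_1 <= u) is at
   most lambda times the integral of P(theta_s in A) over [t - u, t], while the
   mixing hypothesis makes it converge to
   Pbar(A) Pbar(t_1 <= u) >= Pbar(A) lambda u P(T_1 >= u); cutting [a, a + h]
   into short windows gives the lower bound, and complements give the upper
   bound.  Uniform integrability extends this to the unbounded density, and
   delta -> 0 gives Blackwell's limit.  Pointwise convergence of P(theta_s in A)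
   is never needed. *)
Require Import Defs.
From HB Require Import structures.
From mathcomp Require Import all_boot all_order all_algebra.
From mathcomp Require Import all_classical all_reals all_analysis.
From mathcomp Require Import measurable_realfun.
From mathcomp Require Import ring lra zify.
Set Implicit Arguments.
Unset Strict Implicit.
Unset Printing Implicit Defensive.
Import Order.TTheory GRing.Theory Num.Theory.
Import numFieldNormedType.Exports.
Local Open Scope classical_set_scope.
Local Open Scope ring_scope.

(** * Enumerated points and the flow *)

Section Enumerations.
Context {R : realType}.
Implicit Types a b : int -> R.

Lemma int_ltr_homo a : (forall n, a n < a (n + 1)) ->
  {homo a : m n / (m < n)%R >-> m < n}.
Proof.
move=> ha m n mn.
have [k ->] : exists k : nat, n = m + k.+1%:Z.
  by exists (`|n - m|.-1)%N; lia.
elim: k => [|k ih]; first exact: ha.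
apply: (lt_trans ih); have := ha (m + k.+1%:Z).
by rewrite -addrA (_ : k.+1%:Z + 1 = k.+2%:Z)//; lia.
Qed.

Lemma int_ler_mono a : (forall n, a n < a (n + 1)) ->
  {mono a : m n / (m <= n)%R >-> m <= n}.
Proof. by move=> ha; apply: le_mono; exact: int_ltr_homo. Qed.

Lemma int_ltr_mono a : (forall n, a n < a (n + 1)) ->
  {mono a : m n / (m < n)%R >-> m < n}.
Proof. by move=> ha; apply: leW_mono; exact: int_ler_mono. Qed.

(** Index 1 marks the least positive element of the common range in both enumerations. From there
    the range alone determines each successor and each predecessor, so induction in both directions
    identifies the two. *)
Lemma increasing_enum_unique a b :
  (forall n, a n < a (n + 1)) -> (forall n, b n < b (n + 1)) ->
  a 0 <= 0 < a 1 -> b 0 <= 0 < b 1 -> range a = range b -> a = b.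
Proof.
move=> ha hb /andP[a0 a1] /andP[b0 b1] ab.
have la := int_ler_mono ha; have lb := int_ler_mono hb.
have ta := int_ltr_mono ha; have tb := int_ltr_mono hb.
have ina n : exists j, b j = a n.
  have : range a (a n) by exists n.
  by rewrite ab => -[j _ <-]; exists j.
have inb n : exists j, a j = b n.
  have : range b (b n) by exists n.
  by rewrite -ab => -[j _ <-]; exists j.
have ab1 : a 1 = b 1.
  apply/eqP; rewrite eq_le; apply/andP; split.
  - have [j jE] := inb 1; rewrite -jE la.
    have : a 0 < a j by rewrite jE; exact: le_lt_trans b1.
    by rewrite ta; lia.
  - have [j jE] := ina 1; rewrite -jE lb.
    have : b 0 < b j by rewrite jE; exact: le_lt_trans a1.
    by rewrite tb; lia.
have up n : a n = b n -> a (n + 1) = b (n + 1).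
  move=> e; apply/eqP; rewrite eq_le; apply/andP; split.
  - have [j jE] := inb (n + 1); rewrite -jE la.
    have : a n < a j by rewrite jE e.
    by rewrite ta; lia.
  - have [j jE] := ina (n + 1); rewrite -jE lb.
    have : b n < b j by rewrite jE -e.
    by rewrite tb; lia.
have dn n : a (n + 1) = b (n + 1) -> a n = b n.
  move=> e; apply/eqP; rewrite eq_le; apply/andP; split.
  - have [j jE] := ina n; rewrite -jE lb.
    have : b j < b (n + 1) by rewrite jE -e.
    by rewrite tb; lia.
  - have [j jE] := inb n; rewrite -jE la.
    have : a j < a (n + 1) by rewrite jE e.
    by rewrite ta; lia.
apply/funext => n.
have E0 : a 0 = b 0 by apply: dn; rewrite add0r.
elim: n => // n ih.
- by rewrite -addn1 PoszD up.
- apply: dn; rewrite (_ : - n.+1%:Z + 1 = - n%:Z)//; lia.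
Qed.

End Enumerations.

Section Points.
Context {d : measure_display} {Omega : measurableType d} {R : realType}.
Variables (theta : R -> Omega -> Omega) (pt : int -> Omega -> R).
Hypotheses (htheta : measurable_flow theta) (hN : simple_point_process pt)
  (hshift : shift_compatible pt theta).

Lemma pt_lt n w : pt n w < pt (n + 1) w. Proof. by case: hN. Qed.
Lemma pt0_le0 w : pt 0 w <= 0. Proof. by case: hN => _ _ /(_ w)[]. Qed.
Lemma pt1_gt0 w : 0 < pt 1 w. Proof. by case: hN => _ _ /(_ w)[]. Qed.

Lemma ler_pt w : {mono pt ^~ w : m n / (m <= n)%R >-> m <= n}.
Proof. by apply: int_ler_mono => n; exact: pt_lt. Qed.

Lemma ltr_pt w : {mono pt ^~ w : m n / (m < n)%R >-> m < n}.
Proof. by apply: int_ltr_mono => n; exact: pt_lt. Qed.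

Lemma gap_gt0 n w : 0 < gap pt n w.
Proof. by rewrite /gap subr_gt0; have := pt_lt (n - 1) w; rewrite subrK. Qed.

(** Contradicts local finiteness whenever B is bounded; this is how the points are shown to run off
    to both ends of the line. *)
Lemma point_count_infinite (B : set R) w (f : nat -> int) : injective f ->
  (forall n, B (pt (f n) w)) -> point_count pt B w = +oo%E.
Proof.
move=> fI fB; apply/eqyP => M M0.
pose m := (Num.truncn M).+1.
apply: (@le_trans _ _ (m%:R)%:E); first by rewrite lee_fin; apply/ltW/truncnS_gt.
apply: esum_ge; exists (f @` `I_m).
  split => //; exact/finite_image/finite_II.
rewrite fsbig_image//; last by move=> ? ? _ _; exact: fI.
rewrite (eq_fsbigr (fun=> 1%E)); last by move=> i _; rewrite indicE mem_set.
by rewrite -fsbig_ord sumEFin sumr_const card_ord.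
Qed.

Lemma pt_unbounded_above x w : exists n : nat, x < pt n%:Z w.
Proof.
apply: contrapT => /forallNP h.
case: hN => _ _ _ /(_ [set` `[pt 0 w, x]] w (measurable_itv _)).
rewrite (point_count_infinite (f := Posz)) ?ltxx.
- by move=> bd; have := bd (compact_bounded (@segment_compact R _ _)).
- by move=> ? ? [].
- move=> n; rewrite /= in_itv/= ler_pt; apply/andP; split => //.
  by rewrite leNgt; apply/negP/h.
Qed.

Lemma pt_unbounded_below x w : exists n : nat, pt (- n%:Z) w <= x.
Proof.
apply: contrapT => /forallNP h.
case: hN => _ _ _ /(_ [set` `[x, pt 0 w]] w (measurable_itv _)).
rewrite (point_count_infinite (f := fun n => - n%:Z)) ?ltxx.
- by move=> bd; have := bd (compact_bounded (@segment_compact R _ _)).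
- by move=> ? ? /oppr_inj[].
- move=> n; rewrite /= in_itv/= ler_pt oppr_le0 andbC/=.
  by apply/ltW; rewrite ltNge; apply/negP/h.
Qed.

Lemma pt_cell s w : exists n : int, pt n w <= s < pt (n + 1) w.
Proof.
have [m ms] := pt_unbounded_below s w.
have ex : exists k : nat, s < pt (- m%:Z + k%:Z) w.
  have [n sn] := pt_unbounded_above s w; exists (m + n)%N.
  by rewrite PoszD addrA addNr add0r.
(* The least k whose point exceeds s is positive, because the point at k = 0 lies at or before s;
   the index just before it opens the cell. *)
case: (ex_minnP ex) => -[|k] sk kmin; first by move: sk; rewrite addr0 ltNge ms.
exists (- m%:Z + k%:Z); apply/andP; split.
  by rewrite leNgt; apply/negP => /kmin; rewrite ltnn.
by rewrite -addrA -PoszD addn1.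
Qed.

Lemma pt_cell_unique s w (m n : int) :
  pt m w <= s < pt (m + 1) w -> pt n w <= s < pt (n + 1) w -> m = n.
Proof.
move=> /andP[ms sm] /andP[ns sn].
have := le_lt_trans ms sn; have := le_lt_trans ns sm.
by rewrite !ltr_pt; lia.
Qed.

(** [interval_index] is the index of the right end of the cell, hence the shift by one. *)
Lemma interval_indexE s w (n : int) :
  pt n w <= s < pt (n + 1) w -> interval_index pt s w = n + 1.
Proof.
move=> sn; rewrite /interval_index; case: xgetP => [k _ [k1 k2]|/(_ (n + 1))].
  have := @pt_cell_unique s w (k - 1) n _ sn; rewrite subrK k1 k2 => <- //.
  by rewrite subrK.
by move=> nn; exfalso; apply: nn; case/andP: sn => s1 s2; split; rewrite ?addrK.
Qed.

Lemma point_count1_gt0 x w : (0 < point_count pt [set x] w)%E <-> range (pt ^~ w) x.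
Proof.
split=> [|[n _ nx]].
  apply: contraPP => nr; rewrite /point_count esum1 ?ltxx// => n _.
  by rewrite indicE memNset//= => e; apply: nr; exists n.
apply: (@lt_le_trans _ _ 1%E) => //; apply: esum_ge.
by exists [set n]; [split|rewrite fsbig_set1 indicE mem_set].
Qed.

(** [shift_compatible] speaks of counts only. On singletons it shows that the point set of theta_s w
    is that of w moved by -s. Since n is the last index at or before s, both enumerations are
    anchored at the origin in the same way and therefore coincide. *)
Lemma pt_shift s w (n : int) : pt n w <= s < pt (n + 1) w ->
  forall j, pt j (theta s w) = pt (j + n) w - s.
Proof.
move=> /andP[ns sn] j.
apply: (congr1 (fun f => f j) (@increasing_enum_unique _ (pt ^~ (theta s w))
  (fun j => pt (j + n) w - s) _ _ _ _ _)).
- by move=> k; exact: pt_lt.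
- by move=> k; rewrite ltrD2r ltr_pt; lia.
- by rewrite pt0_le0 pt1_gt0.
- by rewrite add0r subr_le0 ns subr_gt0 addrC sn.
- apply/seteqP; split => x.
    move=> /point_count1_gt0; rewrite hshift//; last exact/compact_bounded/compact_set1.
    rewrite image_set1 => /point_count1_gt0[k _ /= kx].
    by exists (k - n) => //=; rewrite subrK kx addrK.
  move=> [k _ /= kx]; apply/point_count1_gt0.
  rewrite hshift//; last exact/compact_bounded/compact_set1.
  rewrite image_set1; apply/point_count1_gt0; exists (k + n) => //=.
  by rewrite -kx subrK.
Qed.

Lemma gap_shift s w (n : int) : pt n w <= s < pt (n + 1) w ->
  forall j, gap pt j (theta s w) = gap pt (j + n) w.
Proof.
move=> sn j; rewrite /gap !(pt_shift sn) opprB addrA subrK.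
by congr (_ - pt _ w); lia.
Qed.

Lemma past_gaps_shift s w (n : int) : pt n w <= s < pt (n + 1) w ->
  past_gaps pt 0 (theta s w) = past_gaps pt n w.
Proof.
move=> sn; apply/funext => k; rewrite /past_gaps (gap_shift sn); congr gap.
by lia.
Qed.

(** The process is thus a fixed function evaluated along the flow, so that it can enter occupation
    integrals. *)
Lemma lambda_tilde_shift (gv : (nat -> R) -> R) s w :
  lambda_tilde pt gv s w = (gv (past_gaps pt 0 (theta s w)))^-1.
Proof.
have [n sn] := pt_cell s w.
by rewrite /lambda_tilde (interval_indexE sn) addrK (past_gaps_shift sn).
Qed.

Lemma residual_time0 w : residual_time pt 0 w = pt 1 w.
Proof.
rewrite /residual_time (@interval_indexE _ _ 0) ?subr0 ?add0r//.
by rewrite pt0_le0 pt1_gt0.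
Qed.

End Points.

(** * Layer-cake representation *)

Section Measurability.
Context {d : measure_display} {X : measurableType d} {R : realType}.
Implicit Types f g : X -> R.

Lemma measurable_ltr_set f g : measurable_fun setT f -> measurable_fun setT g ->
  measurable [set x | f x < g x].
Proof.
move=> mf mg.
have := measurable_fun_ltr mf mg measurableT (Y := [set true]).
by rewrite setTI; apply.
Qed.

Lemma measurable_ler_set f g : measurable_fun setT f -> measurable_fun setT g ->
  measurable [set x | f x <= g x].
Proof.
move=> mf mg.
have := measurable_fun_ler mf mg measurableT (Y := [set true]).
by rewrite setTI; apply.
Qed.

Lemma measurable_funV f : measurable_fun setT f -> (forall x, 0 < f x) ->
  measurable_fun setT (fun x => (f x)^-1).
Proof.
move=> mf f0; rewrite (_ : (fun _ => _) = (@powR R ^~ (-1)) \o f).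
  by apply: measurableT_comp => //; exact: measurable_powR.
by apply/funext => x /=; rewrite powR_inv1// ltW.
Qed.

End Measurability.

Section LayerCake.
Context {R : realType}.
Local Open Scope ereal_scope.

(** Tonelli's theorem on the region under the graph of Z, after writing Z(x) as the length of [0,
    Z(x)). *)
Lemma ge0_layer_cake d (X : measurableType d)
    (mu : {sigma_finite_measure set X -> \bar R}) (W : X -> \bar R) (Z : X -> R) :
  measurable_fun [set: X] W -> (forall x, 0 <= W x) ->
  measurable_fun [set: X] Z -> (forall x, (0 <= Z x)%R) ->
  \int[mu]_x (W x * (Z x)%:E) =
  \int[lebesgue_measure]_(r in `[0%R, +oo[) \int[mu]_(x in [set x | (r < Z x)%R]) W x.
Proof.
move=> mW W0 mZ Z0.
pose D : set (X * measurableTypeR R) := [set z | (0 <= z.2 < Z z.1)%R].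
have mD : measurable D.
  rewrite (_ : D = [set z | (0 <= z.2)%R] `&` [set z | (z.2 < Z z.1)%R]); last first.
    by apply/seteqP; split=> z /=; [move=> /andP[]|move=> [? ?]; apply/andP].
  apply: measurableI.
    exact: measurable_ler_set.
  apply: measurable_ltr_set => //; exact: measurableT_comp.
pose f (z : X * measurableTypeR R) := W z.1 * (\1_D z)%:E.
have mf : measurable_fun setT f.
  apply: emeasurable_funM; first exact: measurableT_comp.
  by apply/measurable_EFinP; exact: measurable_indic.
have f0 z : 0 <= f z by rewrite mule_ge0.
transitivity (\int[mu]_x \int[lebesgue_measure]_r f (x, r)).
  apply: eq_integral => x _; rewrite /f /=.
  have DE : (fun r => \1_D (x, r)) = \1_`[0%R, Z x[ :> (R -> R).
    by apply/funext => r; rewrite !indicE; congr (_ %:R); apply/idP/idP; rewrite !inE /D/= in_itv.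
  have := congr1 (fun h : R -> R => \int[lebesgue_measure]_r (W x * (h r)%:E)) DE.
  move=> /= ->.
  rewrite ge0_integralZl//; last first.
    by apply/measurable_EFinP; exact: measurable_indic.
  rewrite integral_indic// setIT; congr (_ * _).
  transitivity (lebesgue_measure (`[0%R, Z x[%classic : set R)); last by [].
  rewrite lebesgue_measure_itv/= lte_fin oppr0 adde0.
  by case: ltP => // /(conj (Z0 x))/andP/le_anti<-.
rewrite (fubini_tonelli f)//= [RHS]integral_mkcond; apply: eq_integral => r _.
rewrite patchE; case: ifPn; rewrite ?inE ?notin_setE/= in_itv/= andbT => r0.
  rewrite [RHS]integral_mkcond; apply: eq_integral => x _.
  rewrite patchE /f indicE; case: ifPn; rewrite ?inE ?notin_setE/= => rZ.
    by rewrite mem_set ?mule1// /D/= r0.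
  by rewrite memNset ?mule0// /D/= r0.
rewrite integral0_eq// => x _; rewrite /f indicE memNset ?mule0//.
by rewrite /D/= => /andP[].
Qed.

(** Conditional expectations and the stationary measure are specified on events only; comparing
    superlevel sets extends such identities to unbounded integrands without an approximation by
    simple functions. *)
Lemma ge0_integral_transfer d1 (X1 : measurableType d1) d2 (X2 : measurableType d2)
    (mu1 : {sigma_finite_measure set X1 -> \bar R})
    (mu2 : {sigma_finite_measure set X2 -> \bar R})
    (W1 : X1 -> \bar R) (Z1 : X1 -> R) (W2 : X2 -> \bar R) (Z2 : X2 -> R) :
  measurable_fun [set: X1] W1 -> (forall x, 0 <= W1 x) ->
  measurable_fun [set: X1] Z1 -> (forall x, (0 <= Z1 x)%R) ->
  measurable_fun [set: X2] W2 -> (forall x, 0 <= W2 x) ->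
  measurable_fun [set: X2] Z2 -> (forall x, (0 <= Z2 x)%R) ->
  (forall r, (0 <= r)%R ->
    \int[mu1]_(x in [set x | (r < Z1 x)%R]) W1 x =
    \int[mu2]_(x in [set x | (r < Z2 x)%R]) W2 x) ->
  \int[mu1]_x (W1 x * (Z1 x)%:E) = \int[mu2]_x (W2 x * (Z2 x)%:E).
Proof.
move=> mW1 W10 mZ1 Z10 mW2 W20 mZ2 Z20 h; rewrite !ge0_layer_cake//.
by apply: eq_integral => r; rewrite inE/= in_itv/= andbT => /h.
Qed.

End LayerCake.

(** * Conditional means of the gap ratios *)

Section ConditionalMean.
Context {d : measure_display} {Omega : measurableType d} {R : realType}.
Variable P : probability Omega R.
Local Open Scope ereal_scope.

(* The layer cake of 1 / Y reduces the claim to the defining identity of the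
   conditional expectation on the sets {r < 1 / Y}, which belong to <<s H >>. *)
Lemma cond_exp_ratio (H : set (set Omega)) (X Y : Omega -> R) (A : set Omega) :
  <<s H >> `<=` measurable -> measurable_fun setT X ->
  (forall w, (0 <= X w)%R) -> (forall w, (0 < Y w)%R) ->
  cond_exp_version P <<s H >> X Y -> <<s H >> A ->
  \int[P]_(w in A) (X w / Y w)%:E = P A.
Proof.
move=> Hm mX X0 Y0 [YG /measurable_int/measurable_EFinP mY XY] HA.
have mA := Hm _ HA.
have iY0 w : (0 <= (Y w)^-1)%R by rewrite invr_ge0 ltW.
have miY := measurable_funV mY Y0.
have patchM (f : Omega -> R) : \int[P]_(w in A) (f w / Y w)%:E =
    \int[P]_w (((EFin \o f) \_ A) w * (Y w)^-1%:E).
  rewrite integral_mkcond; apply: eq_integral => w _.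
  by rewrite !patchE; case: ifPn; rewrite ?mul0e// EFinM.
have mpatch (f : Omega -> R) : measurable_fun setT f ->
    measurable_fun setT ((EFin \o f) \_ A).
  move=> mf; apply/(measurable_restrictT _ mA)/measurable_EFinP.
  exact: measurable_funTS.
have patch0 (f : Omega -> R) : (forall w, (0 <= f w)%R) ->
    forall w, 0 <= ((EFin \o f) \_ A) w.
  by move=> f0 w; apply: erestrict_ge0 => {}w _; rewrite lee_fin.
rewrite patchM (ge0_integral_transfer (mu2 := P) (W2 := (EFin \o Y) \_ A)
  (Z2 := fun w => (Y w)^-1%R))//; last first.
- move=> r r0; rewrite -!integral_mkcondr; apply/esym/XY.
  apply: (@measurableI _ (g_sigma_algebraType H)) HA.
  (* The conjunct 0 < y is free because Y is positive; it allows r < 1 / y to be multiplied out into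
     a visibly measurable condition. *)
  rewrite (_ : [set w | _] = Y @^-1` [set y : R | (0 < y)%R /\ (r < y^-1)%R]); last first.
    by apply/seteqP; split=> w /= => [|[]].
  apply: YG.
  rewrite (_ : [set y | _] = [set y : R | (0 < y)%R] `&` [set y : R | (y * r < 1)%R]).
    apply: measurableI; apply: measurable_ltr_set => //.
    by apply: measurable_funM.
  apply/seteqP; split=> y [y0 ry]; split => //=; move: ry => /=.
    by rewrite -[(y^-1)%R]mul1r ltr_pdivlMr// mulrC.
  by rewrite -[(y^-1)%R]mul1r ltr_pdivlMr// mulrC.
- by apply: patch0 => w; exact: ltW.
- exact: mpatch.
- exact: patch0.
- exact: mpatch.
rewrite -patchM -[RHS]mul1e -integral_cst//; apply: eq_integral => w _.
by rewrite divff// gt_eqF.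
Qed.

Variables (theta : R -> Omega -> Omega) (pt : int -> Omega -> R).
Hypotheses (htheta : measurable_flow theta) (hN : simple_point_process pt)
  (hshift : shift_compatible pt theta).

Lemma measurable_flow_at t : measurable_fun setT (theta t).
Proof. by case: htheta => mth _ _; exact: measurable_fun_pair2 mth. Qed.

Lemma measurable_pt n : measurable_fun setT (pt n).
Proof. by case: hN. Qed.

Lemma measurable_gap n : measurable_fun setT (gap pt n).
Proof. by apply: measurable_funB; exact: measurable_pt. Qed.

(** Gives measurability of the residual time, defined through a choice of index, as a composition of
    measurable maps. *)
Lemma residual_time_shift t w : residual_time pt t w = pt 1 (theta t w).
Proof.
have [n tn] := pt_cell hN t w.
by rewrite /residual_time (interval_indexE hN tn) (pt_shift hN hshift tn) [(n + 1)%R]addrC.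
Qed.

Lemma filtration_measurable t : filtration pt t `<=` measurable.
Proof.
apply: smallest_sub; first exact: sigma_algebra_measurable.
move=> A [[u [B [_ mB ->]]]|[n ->]].
  rewrite (_ : residual_time pt u = pt 1 \o theta u); last first.
    by apply/funext => w; rewrite residual_time_shift.
  rewrite -[X in measurable X]setTI.
  by apply: measurableT_comp mB => //; [exact: measurable_pt|exact: measurable_flow_at].
by apply: measurable_ler_set => //; exact: measurable_pt.
Qed.

Lemma strict_past_measurable n : strict_past pt (pt n) `<=` measurable.
Proof.
apply: smallest_sub; first exact: sigma_algebra_measurable.
move=> _ [t [A [/filtration_measurable mA ->]]].
by apply: measurableI => //; apply: measurable_ltr_set => //; exact: measurable_pt.
Qed.

(** The event is the difference of {a < t_n} and {b < t_n}, which are generators of the strict past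
    with A the whole space. This predictability lets the conditional mean of a gap be used on the
    event that its opening point falls in a given interval. *)
Lemma strict_past_interval n a b :
  strict_past pt (pt n) [set w | (a < pt n w <= b)%R].
Proof.
have gt t : strict_past pt (pt n) [set w | (t < pt n w)%R].
  apply: sub_gen_smallest; exists t, setT; split; last by rewrite setTI.
  exact: (@measurableT _ (g_sigma_algebraType _)).
rewrite (_ : [set w | _] = [set w | (a < pt n w)%R] `\` [set w | (b < pt n w)%R]).
  exact: (@measurableD _ (g_sigma_algebraType
    [set C | exists (t : R) (A : set Omega),
      filtration pt t A /\ C = A `&` [set w | (t < pt n w)%R]]) _ _ (gt a) (gt b)).
apply/seteqP; split => w /=.
  by move=> /andP[-> +]; rewrite leNgt => /negP.
by move=> [-> /negP]; rewrite -leNgt.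
Qed.

Variables (v : R) (gv : (nat -> R) -> R).
Hypotheses (v0 : (0 < v)%R) (hgv : truncated_mean_version pt P v gv).

Lemma gv_gt0 x : (0 < gv x)%R. Proof. by case: hgv => _ /(_ x)[]. Qed.

(** Read off from the integrability of the version for gap n + 1, which is available from gap 1
    onwards; hence the natural index. *)
Lemma measurable_gv (n : nat) :
  measurable_fun setT (fun w => gv (past_gaps pt n%:Z w)).
Proof.
have [_ _ _ /(_ (n%:Z + 1)%R _)[|_ + _]] := hgv; first by lia.
by rewrite addrK => /measurable_int/measurable_EFinP.
Qed.

(** Indexed by the point that opens the gap: gap n + 1 is divided by its mean given the gaps up to
    n. *)
Definition gap_ratio (n : int) (w : Omega) : R :=
  Num.min (gap pt (n + 1)%R w) v / gv (past_gaps pt n w).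

Lemma gap_ratio_ge0 n w : (0 <= gap_ratio n w)%R.
Proof.
by rewrite divr_ge0// ?le_min ?(ltW v0) ?andbT ltW ?gv_gt0// gap_gt0.
Qed.

Lemma measurable_gap_ratio (n : nat) : measurable_fun setT (gap_ratio n).
Proof.
apply: measurable_funM.
  by apply: measurable_minr => //; exact: measurable_gap.
by apply: measurable_funV; [exact: measurable_gv|move=> w; exact: gv_gt0].
Qed.

Lemma gap_ratio_mean (n : nat) A : strict_past pt (pt n%:Z) A ->
  \int[P]_(w in A) (gap_ratio n w)%:E = P A.
Proof.
move=> pA; have [_ _ _ /(_ (n%:Z + 1)%R _)] := hgv; rewrite !addrK => cv.
apply: cond_exp_ratio (cv _) pA.
- exact: strict_past_measurable.
- by apply: measurable_minr => //; exact: measurable_gap.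
- by move=> w; rewrite le_min ?(ltW v0) ?andbT ltW// gap_gt0.
- by move=> w; exact: gv_gt0.
- by lia.
Qed.

End ConditionalMean.

(** * Product integrals and translations *)

Section ProductIntegrals.
Local Open Scope ereal_scope.
Context {d1 d2 : measure_display} {T1 : measurableType d1} {T2 : measurableType d2}
  {R : realType}.

Section Sections.
Variables (m1 : {sigma_finite_measure set T1 -> \bar R})
  (m2 : {sigma_finite_measure set T2 -> \bar R}).
Variables (E : set (T1 * T2)) (f : T1 * T2 -> \bar R).
Hypotheses (mE : measurable E) (mf : measurable_fun setT f) (f0 : forall z, 0 <= f z).

Lemma ge0_integral_section1 :
  \int[m1 \x m2]_(z in E) f z = \int[m1]_x \int[m2]_(y in [set y | E (x, y)]) f (x, y).
Proof.
rewrite integral_mkcond fubini_tonelli1; last 2 first.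
- by apply/(measurable_restrictT _ mE); exact: measurable_funTS.
- by apply: erestrict_ge0 => z _.
apply: eq_integral => x _; rewrite /fubini_F [RHS]integral_mkcond.
by apply: eq_integral => y _; rewrite !patchE.
Qed.

Lemma ge0_integral_section2 :
  \int[m1 \x m2]_(z in E) f z = \int[m2]_y \int[m1]_(x in [set x | E (x, y)]) f (x, y).
Proof.
rewrite integral_mkcond fubini_tonelli2; last 2 first.
- by apply/(measurable_restrictT _ mE); exact: measurable_funTS.
- by apply: erestrict_ge0 => z _.
apply: eq_integral => y _; rewrite /fubini_G [RHS]integral_mkcond.
by apply: eq_integral => x _; rewrite !patchE.
Qed.

Lemma measurable_fun_integral_section1 :
  measurable_fun setT (fun x => \int[m2]_(y in [set y | E (x, y)]) f (x, y)).
Proof.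
rewrite (_ : (fun _ => _) = fubini_F m2 (f \_ E)).
  apply: measurable_fun_fubini_tonelli_F.
    by apply/(measurable_restrictT _ mE); exact: measurable_funTS.
  by apply: erestrict_ge0 => z _.
apply/funext => x; rewrite /fubini_F [LHS]integral_mkcond.
by apply: eq_integral => y _; rewrite !patchE.
Qed.

End Sections.

Section SigmaFinite.
Variables (P : probability T1 R) (m : {sigma_finite_measure set T2 -> \bar R}).

(* The library's canonical sigma-finite structure on products of measures is
   keyed on pairs of subprobabilities; this alias carries the structure needed
   when one factor is infinite. *)
Definition prob_product : set (T1 * T2) -> \bar R := P \x m.

HB.instance Definition _ := Measure.on prob_product.

Let prob_product_sigma_finite : sigma_finite setT prob_product.
Proof.
have [F UF mF] := sigma_finiteT m.
exists (fun n => setT `*` F n); first by rewrite -setX_bigcupr -UF setXTT.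
move=> n; have [mFn Fn] := mF n; split; first exact: measurableX.
rewrite /prob_product product_measure1E// [X in X * _](_ : _ = 1) ?mul1e//.
exact: probability_setT.
Qed.

HB.instance Definition _ := Measure_isSigmaFinite.Build _ _ _ prob_product
  prob_product_sigma_finite.

End SigmaFinite.
End ProductIntegrals.

(** * Translation invariance of Lebesgue measure *)

Section Translation.
Context {R : realType}.
Local Open Scope ereal_scope.

Lemma lebesgue_measure_translate (c : R) (A : set R) : measurable A ->
  lebesgue_measure ((fun x => x + c)%R @^-1` A) = lebesgue_measure A.
Proof.
move=> mA.
have mc : measurable_fun [set: measurableTypeR R]
    ((fun x : R => (x + c)%R) : R -> measurableTypeR R) by exact: measurable_funD.
pose tr (x : measurableTypeR R) : measurableTypeR R := (x + c)%R.
(* The image measure agrees with Lebesgue measure on half-open intervals, and these determine it. *)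
pose mu := @pushforward _ _ _ _ R (@lebesgue_measure R) tr.
have mtr : measurable_fun setT tr by exact: mc.
pose mui := measure_function_pushforward__canonical__measure_function_Measure
  (@lebesgue_measure R) mtr.
apply/esym.
apply: (@lebesgue_measure_unique _ mui) => //= _ [[a b]] _ <-.
rewrite /pushforward.
rewrite (_ : tr @^-1` _ = `](a - c)%R, (b - c)%R]%classic); last first.
  by apply/seteqP; split=> x /=; rewrite !in_itv/= ltrBlDr lerBrDr.
by rewrite !lebesgue_measure_itv/= !lte_fin ltrD2r -!EFinB; case: ifP => // _; congr EFin; ring.
Qed.

End Translation.

(** * Occupation integrals of the flow *)

Section FlowAverages.
Context {d : measure_display} {Omega : measurableType d} {R : realType}.
Variables (theta : R -> Omega -> Omega) (pt : int -> Omega -> R)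
  (P Pbar : probability Omega R).
Hypotheses (htheta : measurable_flow theta) (hN : simple_point_process pt)
  (hshift : shift_compatible pt theta) (hPalm : palm_distribution pt theta P)
  (hPbar : stationary_distribution pt theta P Pbar).
Local Open Scope ereal_scope.
Local Notation leb := (@lebesgue_measure R).
Local Notation GR := (measurableTypeR R).
Implicit Types (a b c k : R) (Z : Omega -> R).

Lemma measurable_flow_swap :
  measurable_fun setT (fun z : Omega * GR => theta z.2 z.1).
Proof.
case: htheta => mth _ _.
exact: (@measurableT_comp _ _ _ _ _ _ _ setT _ mth (@measurable_swap _ _ Omega GR)).
Qed.

Lemma measurable_path w : measurable_fun [set: GR] (fun s => theta s w).
Proof. exact: (measurableT_comp measurable_flow_swap (pair1_measurable w)). Qed.

Lemma measurable_flow_fun (Z : Omega -> R) : measurable_fun setT Z ->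
  measurable_fun setT (fun z : Omega * GR => (Z (theta z.2 z.1))%:E).
Proof.
by move=> mZ; apply/measurable_EFinP; apply: measurableT_comp measurable_flow_swap.
Qed.

Lemma measurable_palm_cell : measurable [set z : Omega * GR | (0 <= z.2 <= gap pt 1 z.1)%R].
Proof.
rewrite (_ : [set _ | _] = [set z | (0 <= z.2)%R] `&` [set z | (z.2 <= gap pt 1 z.1)%R]).
  apply: measurableI; apply: measurable_ler_set => //.
  by apply: measurableT_comp => //; exact: measurable_gap.
by apply/seteqP; split=> z /=; [move=> /andP[]|move=> [? ?]; apply/andP].
Qed.

(** Half-open in time, so that adjacent strips are disjoint and occupation integrals add up. *)
Definition strip (a b : R) : set (Omega * GR) := [set z | (a < z.2 <= b)%R].

Lemma measurable_strip a b : measurable (strip a b).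
Proof.
rewrite (_ : strip a b = [set z | (a < z.2)%R] `&` [set z | (z.2 <= b)%R]).
  by apply: measurableI; [apply: measurable_ltr_set|apply: measurable_ler_set].
by apply/seteqP; split=> z /=; [move=> /andP[]|move=> [? ?]; apply/andP].
Qed.

(** By the conventions for [fine] and for the inverse of 0, a degenerate mean gap would give
    intensity 0; then Pbar would have total mass 0 instead of 1. *)
Lemma intensity_gt0 : (0 < intensity pt P)%R.
Proof.
rewrite lt0r; apply/andP; split; last first.
  rewrite invr_ge0 fine_ge0// expectation_ge0// => w.
  by rewrite ltW// gap_gt0.
apply/eqP => i0; have := hPbar measurableT.
by rewrite probability_setT i0 mul0e => /eqP; rewrite onee_eq0.
Qed.

(** The P-mean of the time integral of Z along the flow over (a, b], set on the product space so
    that either order of integration is at hand. *)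
Definition occupation (a b : R) (Z : Omega -> R) : \bar R :=
  \int[P \x leb]_(z in strip a b) (Z (theta z.2 z.1))%:E.

Lemma occupationE a b Z : measurable_fun setT Z -> (forall w, (0 <= Z w)%R) ->
  occupation a b Z = \int[P]_w \int[leb]_(t in `]a, b]) (Z (theta t w))%:E.
Proof.
move=> mZ Z0; rewrite /occupation ge0_integral_section1//.
- exact: measurable_strip.
- exact: measurable_flow_fun.
- by move=> z; rewrite lee_fin.
Qed.

Lemma occupationE2 a b Z : measurable_fun setT Z -> (forall w, (0 <= Z w)%R) ->
  occupation a b Z = \int[leb]_(t in `]a, b]) \int[P]_w (Z (theta t w))%:E.
Proof.
move=> mZ Z0; rewrite /occupation ge0_integral_section2//; last 3 first.
- exact: measurable_strip.
- exact: measurable_flow_fun.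
- by move=> z; rewrite lee_fin.
rewrite [RHS]integral_mkcond; apply: eq_integral => t _.
rewrite patchE set_itvE; case: ifPn; rewrite ?inE ?notin_setE/= => tab.
  rewrite (_ : [set w : Omega | strip a b (w, t)] = setT)//.
  by apply/seteqP; split => // w _.
rewrite integral_mkcond; apply: integral0_eq => w _; rewrite patchE memNset//.
Qed.

Lemma occupation_ge0 a b Z : (forall w, (0 <= Z w)%R) -> 0 <= occupation a b Z.
Proof. by move=> Z0; apply: integral_ge0 => z _; rewrite lee_fin. Qed.

Lemma le_occupation a b Z1 Z2 : measurable_fun setT Z1 -> measurable_fun setT Z2 ->
  (forall w, (0 <= Z1 w)%R) -> (forall w, (Z1 w <= Z2 w)%R) ->
  occupation a b Z1 <= occupation a b Z2.
Proof.
move=> m1 m2 Z0 Z12; apply: ge0_le_integral.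
- exact: measurable_strip.
- by move=> z _; rewrite lee_fin.
- by apply: measurable_funTS; exact: measurable_flow_fun.
- by apply: measurable_funTS; exact: measurable_flow_fun.
- by move=> z _; rewrite lee_fin.
Qed.

Lemma occupationD a b Z1 Z2 : measurable_fun setT Z1 -> measurable_fun setT Z2 ->
  (forall w, (0 <= Z1 w)%R) -> (forall w, (0 <= Z2 w)%R) ->
  occupation a b (fun w => Z1 w + Z2 w)%R = occupation a b Z1 + occupation a b Z2.
Proof.
move=> m1 m2 Z10 Z20; rewrite /occupation -ge0_integralD//.
- exact: measurable_strip.
- by move=> z _; rewrite lee_fin.
- by apply: measurable_funTS; exact: measurable_flow_fun.
- by move=> z _; rewrite lee_fin.
- by apply: measurable_funTS; exact: measurable_flow_fun.
Qed.

Lemma occupationZ a b (k : R) Z : measurable_fun setT Z ->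
  (forall w, (0 <= Z w)%R) -> (0 <= k)%R ->
  occupation a b (fun w => k * Z w)%R = k%:E * occupation a b Z.
Proof.
move=> mZ Z0 k0; rewrite /occupation -ge0_integralZl_EFin//.
- exact: measurable_strip.
- by move=> z _; rewrite lee_fin.
- by apply: measurable_funTS; exact: measurable_flow_fun.
Qed.

Lemma occupation_cst a b (k : R) : (a <= b)%R -> (0 <= k)%R ->
  occupation a b (cst k) = (k * (b - a))%:E.
Proof.
move=> ab k0; rewrite occupationE2//.
transitivity (\int[leb]_(t in `]a, b]) (cst k%:E t)).
  apply: eq_integral => t _.
  transitivity (k%:E * P setT); last by rewrite probability_setT mule1.
  by rewrite -integral_cst.
rewrite integral_cst//.
transitivity (k%:E * leb (`]a, b]%classic : set R)) => //.
rewrite lebesgue_measure_itv/= lte_fin EFinM EFinB.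
by case: ltgtP ab => // -> _; rewrite subee.
Qed.

Lemma occupation_cat a b c Z : measurable_fun setT Z -> (forall w, (0 <= Z w)%R) ->
  (a <= b)%R -> (b <= c)%R ->
  occupation a c Z = occupation a b Z + occupation b c Z.
Proof.
move=> mZ Z0 ab bc; rewrite /occupation -ge0_integral_setU//.
- congr integral; apply/seteqP; split => z /=.
    by move=> /andP[az zc]; rewrite /strip/= az zc/= andbT; case: leP; [left|right].
  move=> []/andP[z1 z2]; apply/andP; split => //.
    exact: le_trans bc.
  exact: le_lt_trans z1.
- exact: measurable_strip.
- exact: measurable_strip.
- by apply: measurable_funTS; exact: measurable_flow_fun.
- by move=> z _; rewrite lee_fin.
- apply/disj_setPLR => z /andP[_ zb] /andP[bz _].
  by move: (lt_le_trans bz zb); rewrite ltxx.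
Qed.

End FlowAverages.

(** * Stationary means and Palm cycles *)

Section StationaryAverages.
Context {d : measure_display} {Omega : measurableType d} {R : realType}.
Variables (theta : R -> Omega -> Omega) (pt : int -> Omega -> R)
  (P Pbar : probability Omega R).
Hypotheses (htheta : measurable_flow theta) (hN : simple_point_process pt)
  (hshift : shift_compatible pt theta) (hPalm : palm_distribution pt theta P)
  (hPbar : stationary_distribution pt theta P Pbar).
Local Open Scope ereal_scope.
Local Notation leb := (@lebesgue_measure R).
Local Notation GR := (measurableTypeR R).
Local Notation lambda := (intensity pt P).
Local Notation occupation := (occupation theta P).
Implicit Types (a b c k : R) (Z : Omega -> R).

Lemma stationary_integral Z : measurable_fun setT Z -> (forall w, (0 <= Z w)%R) ->
  \int[Pbar]_w (Z w)%:E = lambda%:E *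
    \int[P]_w \int[leb]_(t in `[0%R, gap pt 1 w]) (Z (theta t w))%:E.
Proof.
move=> mZ Z0.
have l0 : (0 <= lambda)%R by apply/ltW; exact: (intensity_gt0 hN hPbar).
pose cell := [set z : Omega * GR | (0 <= z.2 <= gap pt 1 z.1)%R].
have mcell : measurable cell by exact: (measurable_palm_cell hN).
have cellE (Z' : Omega -> R) : measurable_fun setT Z' -> (forall w, (0 <= Z' w)%R) ->
    \int[P]_w \int[leb]_(t in `[0%R, gap pt 1 w]) (Z' (theta t w))%:E =
    \int[P \x leb]_(z in cell) (Z' (theta z.2 z.1))%:E.
  move=> mZ' Z'0; rewrite ge0_integral_section1//.
    exact: (measurable_flow_fun htheta).
  by move=> z; rewrite lee_fin.
have mflow Z' : measurable_fun setT Z' ->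
    measurable_fun setT (fun z : Omega * GR => Z' (theta z.2 z.1)).
  by move=> mZ'; apply/measurable_EFinP; exact: (measurable_flow_fun htheta).
transitivity (\int[Pbar]_w (cst 1 w * (Z w)%:E)).
  by apply: eq_integral => w _; rewrite mul1e.
pose mu2 : {sigma_finite_measure set (Omega * GR)%type -> \bar R} := prob_product P leb.
(* Pbar with weight 1 is compared with P times Lebesgue measure weighted by lambda on the first
   cycle; on superlevel sets this is the definition of Pbar. *)
rewrite (ge0_integral_transfer (mu2 := mu2) (W2 := (cst lambda%:E) \_ cell)
  (Z2 := fun z => Z (theta z.2 z.1)))//; last first.
- move=> r r0.
  have mr : measurable [set w | (r < Z w)%R] by exact: measurable_ltr_set.
  transitivity (Pbar [set w | (r < Z w)%R]); first by rewrite integral_cst// mul1e.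
  have mi : measurable_fun setT (\1_[set w | (r < Z w)%R] : Omega -> R).
    exact: measurable_indic.
  rewrite hPbar// (cellE _ mi)//.
  rewrite -ge0_integralZl_EFin//; last first.
    by apply: measurable_funTS; exact: (measurable_flow_fun htheta mi).
  rewrite integral_mkcond [RHS]integral_mkcond; apply: eq_integral => z _.
  rewrite !patchE indicE.
  case: (boolP (z \in cell)) => zc; case: ifPn; rewrite ?inE ?notin_setE/= => rz //.
    by rewrite mem_set// mule1.
  by rewrite memNset// mule0.
- exact: mflow.
- by apply: erestrict_ge0 => z _; rewrite lee_fin.
- exact/(measurable_restrictT _ mcell).
rewrite cellE// -ge0_integralZl_EFin//; last first.
- by apply: measurable_funTS; exact: (measurable_flow_fun htheta).
- by move=> z _; rewrite lee_fin.
rewrite [RHS]integral_mkcond; apply: eq_integral => z _.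
by rewrite !patchE; case: ifPn; rewrite ?mul0e.
Qed.

Definition palm_zero : set Omega := [set w | pt 0 w = 0%R].

Lemma measurable_palm_zero : measurable palm_zero.
Proof.
rewrite (_ : palm_zero = pt 0 @^-1` [set 0%R]) // -[X in measurable X]setTI.
exact: (measurable_pt hN).
Qed.

Lemma integral_palm_zero (f : Omega -> \bar R) : measurable_fun setT f ->
  (forall w, 0 <= f w) -> \int[P]_w f w = \int[P]_(w in palm_zero) f w.
Proof.
move=> mf f0; have mz := measurable_palm_zero.
have N0 : P (~` palm_zero) = 0.
  by rewrite probability_setC// [P palm_zero](proj1 hPalm) subee.
rewrite (@ge0_negligible_integral _ _ _ _ setT (~` palm_zero))//.
- by rewrite setTD setCK.
- exact: measurableC.
Qed.

Lemma palm_pt1 w s : palm_zero w -> (0 <= s < gap pt 1 w)%R ->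
  pt 1 (theta s w) = (gap pt 1 w - s)%R.
Proof.
rewrite /palm_zero/= /gap subrr => w0; rewrite w0 subr0 => s01.
rewrite (@pt_shift _ _ _ _ _ hN hshift s w 0)// ?addr0// add0r w0//.
Qed.

Lemma measurable_fun_section (f : Omega -> GR -> R) a b :
  measurable_fun setT (fun z : Omega * GR => f z.1 z.2) -> (forall w t, (0 <= f w t)%R) ->
  measurable_fun setT (fun w => \int[leb]_(t in `]a, b]) (f w t)%:E).
Proof.
move=> mf f0.
apply: (@measurable_fun_integral_section1 _ _ _ _ _ leb (strip a b)
  (fun z : Omega * GR => (f z.1 z.2)%:E)).
- exact: measurable_strip.
- exact/measurable_EFinP.
- by move=> z; rewrite lee_fin.
Qed.

(* For s in [0, T_1) with T_1 - s <= u, put r = s + t - T_1: then r lies in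
   [t - u, t] and theta_(s + t) = theta_r o theta_(t_1), where theta_(t_1)
   preserves P. *)
Lemma stationary_le_occupation A (u t : R) : measurable A -> (0 <= u)%R ->
  Pbar ((theta t @^-1` A) `&` [set w | (pt 1 w <= u)%R]) <=
  lambda%:E * occupation (t - u) t \1_A.
Proof.
move=> mA u0.
have mt := measurable_flow_at htheta.
have mpre s : measurable (theta s @^-1` A) by rewrite -[X in measurable X]setTI; exact: mt.
set B := _ `&` _.
have mB : measurable B.
  by apply: measurableI => //; apply: measurable_ler_set => //; exact: (measurable_pt hN).
rewrite hPbar// lee_pmul2l ?lte_fin ?(intensity_gt0 hN hPbar)//.
(* The intermediate integrand restarts the flow at t_1. It is compared pathwise with the left side,
   and for each fixed r in P-mean with the right side. *)
pose f w (r : GR) : R := \1_A (theta r (theta (pt 1 w) w)).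
have mth1 : measurable_fun setT (fun w => theta (pt 1 w) w).
  pose h w : Omega * GR := (w, pt 1 w).
  apply: (@measurableT_comp _ _ _ _ _ _ (fun z : Omega * GR => theta z.2 z.1) setT h).
    exact: (measurable_flow_swap htheta).
  apply/measurable_fun_pairP; split; first exact: measurable_id.
  exact: (measurable_pt hN).
have mf : measurable_fun setT (fun z : Omega * GR => f z.1 z.2).
  apply: measurableT_comp; first exact: measurable_indic.
  pose h (z : Omega * GR) : Omega * GR := (theta (pt 1 z.1) z.1, z.2).
  apply: (@measurableT_comp _ _ _ _ _ _ (fun z : Omega * GR => theta z.2 z.1) setT h).
    exact: (measurable_flow_swap htheta).
  apply/measurable_fun_pairP; split.
    exact: (@measurableT_comp _ _ _ _ _ _ (fun w => theta (pt 1 w) w)).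
  exact: measurable_snd.
have f0 w r : (0 <= f w r)%R by [].
apply: (@le_trans _ _ (\int[P]_w \int[leb]_(r in `](t - u)%R, t]) (f w r)%:E)); last first.
  have mS := @measurable_strip d Omega R (t - u) t.
  have mfE : measurable_fun setT (fun z : Omega * GR => (f z.1 z.2)%:E).
    exact/measurable_EFinP.
  have fE0 (z : Omega * GR) : 0 <= (f z.1 z.2)%:E by rewrite lee_fin.
  rewrite -[leLHS](ge0_integral_section1 P leb mS mfE fE0).
  rewrite (ge0_integral_section2 P leb mS mfE fE0) /occupation.
  have mi : measurable_fun setT (\1_A : Omega -> R) by exact: measurable_indic.
  have i0 (z : Omega * GR) : 0 <= (\1_A (theta z.2 z.1))%:E :> \bar R by rewrite lee_fin.
  rewrite (ge0_integral_section2 P leb mS (measurable_flow_fun htheta mi) i0).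
  have shift_inv r : \int[P]_(w in [set w | strip (t - u) t (w, r)]) (f w r)%:E =
      \int[P]_(w in [set w | strip (t - u) t (w, r)]) (\1_A (theta r w))%:E.
    have [tr|tr] := pselect (t - u < r <= t)%R; last first.
      rewrite (_ : [set w : Omega | strip (t - u) t (w, r)] = set0) ?integral_set0//.
      by apply/seteqP; split.
    rewrite (_ : [set w : Omega | strip (t - u) t (w, r)] = setT); last first.
      by apply/seteqP; split.
    transitivity (\int[P]_w (\1_[set w | (theta r @^-1` A) (theta (pt 1 w) w)] w)%:E) => //.
    transitivity (\int[P]_w (\1_(theta r @^-1` A) w)%:E) => //.
    rewrite !integral_indic//; last first.
      by rewrite -[X in measurable X]setTI; exact: mth1.
    by rewrite !setIT; exact: (proj2 hPalm).
  by rewrite le_eqVlt; apply/orP; left; apply/eqP/eq_integral => r _; exact: shift_inv.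
have mF := measurable_fun_section (t - u) t mf f0.
have mG : measurable_fun setT
    (fun w => \int[leb]_(s in `[0%R, gap pt 1 w]) (\1_B (theta s w))%:E).
  have mi : measurable_fun setT (\1_B : Omega -> R) by exact: measurable_indic.
  apply: (@measurable_fun_integral_section1 _ _ _ _ _ leb _ _
    (measurable_palm_cell hN) (measurable_flow_fun htheta mi)).
  by move=> z; rewrite lee_fin.
rewrite integral_palm_zero//; last first.
  by move=> w; apply: integral_ge0 => s _; rewrite lee_fin.
rewrite [leRHS]integral_palm_zero//; last first.
  by move=> w; apply: integral_ge0 => s _; rewrite lee_fin.
apply: ge0_le_integral => //.
- exact: measurable_palm_zero.
- by move=> w _; apply: integral_ge0 => s _; rewrite lee_fin.
- exact: measurable_funTS.
- exact: measurable_funTS.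
move=> w w0.
have w1 : pt 1 w = gap pt 1 w by move: w0; rewrite /palm_zero/= /gap subrr => ->; rewrite subr0.
have mpath w' (C : set Omega) : measurable C -> measurable [set s : GR | C (theta s w')].
  by move=> mC; rewrite -[X in measurable X]setTI; exact: (measurable_path htheta).
have mr w' (C : set Omega) : measurable C ->
    measurable_fun setT (fun s : GR => (\1_C (theta s w'))%:E : \bar R).
  move=> mC; apply/measurable_EFinP; apply: measurableT_comp.
    exact: measurable_indic.
  exact: (measurable_path htheta).
(* At s = T_1 the next point is no longer t_1, so this end of the cycle is dropped; the window is
   closed at t - u because T_1 - s = u is allowed. *)
rewrite -integral_itv_bndo_bndc; last by apply: measurable_funTS; exact: mr.
rewrite [leRHS]integral_itv_obnd_cbnd; last by apply: measurable_funTS; exact: mr.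
pose S := [set s : GR | B (theta s w)] `&` `[0%R, gap pt 1 w[%classic.
pose K := [set r : GR | A (theta r (theta (pt 1 w) w))] `&` `[(t - u)%R, t]%classic.
have mS : measurable S by apply: measurableI; [exact: mpath|exact: measurable_itv].
have mK : measurable K by apply: measurableI; [exact: mpath|exact: measurable_itv].
apply: (@le_trans _ _ (leb S)).
  by rewrite (_ : leb S = \int[leb]_(s in `[0%R, gap pt 1 w[) (\1_[set s : GR | B (theta s w)] s)%:E)//
    integral_indic//; exact: mpath.
apply: (@le_trans _ _ (leb K)); last first.
  by rewrite (_ : leb K = \int[leb]_(r in `[(t - u)%R, t]) (\1_[set r : GR | A (theta r (theta (pt 1 w) w))] r)%:E)//
    integral_indic//; exact: mpath.
(* The substitution r = s + t - T_1 carries S into K and preserves length. *)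
rewrite -(lebesgue_measure_translate (t - gap pt 1 w) mK).
apply: le_measure; rewrite ?inE//.
  rewrite -[X in measurable X]setTI; exact: measurable_funD.
move=> s [[/= As us]]; rewrite in_itv/= => s0g.
have th := (let: And3 _ _ th := htheta in th).
rewrite /K/= in_itv/= w1 -th.
move: us; rewrite (palm_pt1 w0 s0g) => us; split.
  rewrite (_ : (s + (t - gap pt 1 w) + gap pt 1 w)%R = (t + s)%R) ?th//; ring.
by move/andP : s0g => [s0 sg]; apply/andP; split; lra.
Qed.

End StationaryAverages.

(** * Integrals of step functions over a cycle *)

Section StepIntegral.
Context {R : realType}.
Local Open Scope ereal_scope.
Local Notation leb := (@lebesgue_measure R).

Lemma integral_step (g k : R) (F : R -> R) (I : interval R) :
  measurable_fun [set: measurableTypeR R] F ->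
  (forall s, (0 <= s < g)%R -> F s = (k * \1_[set` I] s)%R) -> (0 <= k)%R ->
  \int[leb]_(s in `[0%R, g]) (F s)%:E = k%:E * leb ([set` I] `&` `[0%R, g[%classic).
Proof.
move=> mF FI k0.
rewrite -integral_itv_bndo_bndc; last exact/measurable_funTS/measurable_EFinP.
transitivity (\int[leb]_(s in `[0%R, g[) (k%:E * (\1_[set` I] s)%:E)).
  by apply: eq_integral => s; rewrite inE/= in_itv/= => /FI ->; rewrite EFinM.
rewrite ge0_integralZl_EFin//; last first.
  by apply/measurable_funTS/measurable_EFinP; exact: measurable_indic.
by rewrite integral_indic.
Qed.

Lemma lebesgue_itv_lo (g u : R) : (0 <= g)%R -> (0 <= u)%R ->
  leb (`[(g - u)%R, +oo[%classic `&` `[0%R, g[%classic) = (Num.min g u)%:E.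
Proof.
move=> g0 u0.
transitivity (leb (`[(Num.max 0 (g - u))%R, g[%classic : set R)).
  congr (leb _); apply/seteqP; split=> s /=; rewrite !in_itv/= ?andbT ge_max.
    by move=> [-> /andP[-> ->]].
  by move=> /andP[/andP[-> ->] ->].
rewrite lebesgue_measure_itv/= lte_fin -EFinB.
have [gu|ug] := leP g u.
  rewrite (max_idPl _); last by lra.
  by case: ifPn; rewrite ?subr0// -leNgt => g0'; congr EFin; lra.
rewrite (max_idPr _); last by lra.
by case: ifPn => [_|]; rewrite -?leNgt => *; congr EFin; lra.
Qed.

Lemma lebesgue_itv_hi (g u : R) : (0 <= g)%R -> (0 <= u)%R ->
  leb (`]-oo, u[%classic `&` `[0%R, g[%classic) = (Num.min g u)%:E.
Proof.
move=> g0 u0.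
transitivity (leb (`[0%R, (Num.min g u)[%classic : set R)).
  congr (leb _); apply/seteqP; split=> s /=; rewrite !in_itv/= lt_min.
    by move=> [-> /andP[-> ->]].
  by move=> /andP[-> /andP[-> ->]].
rewrite lebesgue_measure_itv/= lte_fin -EFinB subr0 lt_min.
case: ifPn => //; rewrite negb_and -!leNgt => /orP gu; congr EFin.
by rewrite /Num.min; case: ltP => ?; case: gu => ?; lra.
Qed.

End StepIntegral.

(** * Consequences of mixing, and stationary means computed from one cycle *)

Section Limits.
Context {d : measure_display} {Omega : measurableType d} {R : realType}.
Variables (theta : R -> Omega -> Omega) (pt : int -> Omega -> R)
  (P Pbar : probability Omega R).
Hypotheses (htheta : measurable_flow theta) (hN : simple_point_process pt)
  (hshift : shift_compatible pt theta) (hPalm : palm_distribution pt theta P)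
  (hPbar : stationary_distribution pt theta P Pbar)
  (hiii : forall (A : set Omega) (u : R), measurable A -> 0 <= u ->
    Pbar ((theta t @^-1` A) `&` [set w | pt 1 w <= u]) @[t --> +oo] -->
      (Pbar A * Pbar [set w | pt 1 w <= u]%R)%E).
Local Open Scope ereal_scope.
Local Notation leb := (@lebesgue_measure R).
Local Notation GR := (measurableTypeR R).
Local Notation lambda := (intensity pt P).
Local Notation occupation := (occupation theta P).
Implicit Types (a b c k : R) (Z : Omega -> R).

Lemma mixing_lower (A : set Omega) (u e : R) : measurable A -> (0 <= u)%R -> (0 < e)%R ->
  exists t0 : R, forall t, (t0 <= t)%R ->
    Pbar A * Pbar [set w | (pt 1 w <= u)%R] <= lambda%:E * occupation (t - u) t \1_A + e%:E.
Proof.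
move=> mA u0 e0; have := hiii mA u0.
rewrite (_ : Pbar A * _ = (fine (Pbar A) * fine (Pbar [set w | (pt 1 w <= u)%R]))%:E).
  move=> /fine_cvgP[_ /cvgrPdist_lt/(_ _ e0)[M [_ HM]]].
  exists (M + 1)%R => t tM.
  have := stationary_le_occupation htheta hN hshift hPalm hPbar t mA u0.
  move=> /(leeD2r e%:E); apply: le_trans.
  have /= := HM t; rewrite (lt_le_trans _ tM) ?ltrDl// => /(_ erefl).
  set q := Pbar (_ `&` _) => h.
  have qf : q \is a fin_num.
    apply: fin_num_measure; apply: measurableI.
      by rewrite -[X in measurable X]setTI; exact: (measurable_flow_at htheta).
    by apply: measurable_ler_set => //; exact: (measurable_pt hN).
  rewrite -(fineK qf) -EFinD lee_fin.
  by move: h; rewrite ltr_norml => /andP[_]; lra.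
rewrite EFinM !fineK//; apply: fin_num_measure => //.
by apply: measurable_ler_set => //; exact: (measurable_pt hN).
Qed.

Lemma measurable_pt1_le u : measurable [set w | (pt 1 w <= u)%R].
Proof. by apply: measurable_ler_set => //; exact: (measurable_pt hN). Qed.

(** Within a Palm cycle the residual time is at most u exactly on the final stretch [T_1 - u, T_1),
    cut off at 0, which has length min(T_1, u). *)
Lemma residual_cell (F : Omega -> R) (k u : R) w : measurable_fun setT F ->
  palm_zero pt w -> (0 <= k)%R -> (0 <= u)%R ->
  (forall s, (0 <= s < gap pt 1 w)%R ->
    F (theta s w) = (k * \1_[set w' | (pt 1 w' <= u)%R] (theta s w))%R) ->
  \int[leb]_(s in `[0%R, gap pt 1 w]) (F (theta s w))%:E =
    (k * Num.min (gap pt 1 w) u)%:E.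
Proof.
move=> mF w0 k0 u0 hF.
have g0 := ltW (gap_gt0 hN 1 w).
rewrite (@integral_step _ _ k _ `[(gap pt 1 w - u)%R, +oo[) ?lebesgue_itv_lo//.
  exact: (measurableT_comp mF (measurable_path htheta w)).
move=> s s0g; rewrite hF// !indicE; congr (_ * (nat_of_bool _)%:R)%R.
by apply/idP/idP; rewrite !inE/= in_itv/= andbT (palm_pt1 hN hshift w0 s0g); lra.
Qed.

(** The mirror image of [residual_cell]: the mass sits on the initial stretch of the cycle. *)
Lemma age_cell (F : Omega -> R) (k u : R) w : measurable_fun setT F ->
  (0 <= k)%R -> (0 <= u)%R ->
  (forall s, (0 <= s < gap pt 1 w)%R ->
    F (theta s w) = (k * \1_`]-oo, u[ s)%R) ->
  \int[leb]_(s in `[0%R, gap pt 1 w]) (F (theta s w))%:E =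
    (k * Num.min (gap pt 1 w) u)%:E.
Proof.
move=> mF k0 u0 hF; have g0 := ltW (gap_gt0 hN 1 w).
rewrite (@integral_step _ _ k _ `]-oo, u[) ?lebesgue_itv_hi//.
exact: (measurableT_comp mF (measurable_path htheta w)).
Qed.

Lemma stationary_cycle (F G : Omega -> R) : measurable_fun setT F ->
  (forall w, (0 <= F w)%R) -> measurable_fun setT G -> (forall w, (0 <= G w)%R) ->
  (forall w, palm_zero pt w ->
    \int[leb]_(s in `[0%R, gap pt 1 w]) (F (theta s w))%:E = (G w)%:E) ->
  \int[Pbar]_w (F w)%:E = lambda%:E * \int[P]_w (G w)%:E.
Proof.
move=> mF F0 mG G0 FG; rewrite (stationary_integral htheta hN hPbar)//.
congr (_ * _); rewrite (integral_palm_zero hN hPalm); last first.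
- by move=> w; apply: integral_ge0 => s _; rewrite lee_fin.
- apply: (@measurable_fun_integral_section1 _ _ _ _ _ leb _ _
    (measurable_palm_cell hN) (measurable_flow_fun htheta mF)).
  by move=> z; rewrite lee_fin.
rewrite [RHS](integral_palm_zero hN hPalm)//; last exact/measurable_EFinP.
by apply: eq_integral => w; rewrite inE => /FG.
Qed.

(** The event occupies length min(T_1, u) of a cycle, and this is at least u when T_1 >= u. *)
Lemma stationary_pt1_le (u : R) : (0 <= u)%R ->
  lambda%:E * (u%:E * P [set w | (u <= gap pt 1 w)%R]) <= Pbar [set w | (pt 1 w <= u)%R].
Proof.
move=> u0; have mu := measurable_pt1_le u.
have mg := measurable_gap hN 1.
have -> : Pbar [set w | (pt 1 w <= u)%R] =
    \int[Pbar]_w (\1_[set w | (pt 1 w <= u)%R] w)%:E by rewrite integral_indic// setIT.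
rewrite (@stationary_cycle _ (fun w => Num.min (gap pt 1 w) u))//.
- rewrite lee_pmul2l ?lte_fin ?(intensity_gt0 hN hPbar)//.
  have mU : measurable [set w | (u <= gap pt 1 w)%R] by exact: measurable_ler_set.
  have -> : P [set w | (u <= gap pt 1 w)%R] =
    \int[P]_w (\1_[set w | (u <= gap pt 1 w)%R] w)%:E by rewrite integral_indic// setIT.
  rewrite -ge0_integralZl_EFin//; last first.
    by apply/measurable_EFinP; exact: measurable_indic.
  apply: ge0_le_integral => //.
  - by move=> w _; rewrite -EFinM lee_fin mulr_ge0.
  - by apply: measurable_funeM; apply/measurable_EFinP; exact: measurable_indic.
  - by apply/measurable_EFinP; exact: measurable_minr.
  - move=> w _; rewrite -EFinM lee_fin indicE; case: (boolP (w \in _)); rewrite ?inE/= => uw.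
      by rewrite mulr1 le_min lexx uw.
    by rewrite mulr0 le_min u0 ltW// (gap_gt0 hN).
- exact: measurable_minr.
- by move=> w; rewrite le_min u0 ltW// (gap_gt0 hN).
- move=> w w0.
  have mi : measurable_fun setT (\1_[set w | (pt 1 w <= u)%R] : Omega -> R).
    exact: measurable_indic.
  have := @residual_cell _ 1 u w mi w0 ler01 u0; rewrite mul1r; apply => s _.
  by rewrite mul1r.
Qed.

(** Continuity from below: gaps are positive, so the events {T_1 >= 1/(n+1)} increase to the whole
    space. *)
Lemma gap_gt_near1 (e : R) : (0 < e)%R ->
  exists2 u : R, (0 < u)%R & forall u', (u' <= u)%R ->
    (1 - e)%:E <= P [set w | (u' <= gap pt 1 w)%R].
Proof.
move=> e0; have mg := measurable_gap hN 1.
pose F n := [set w | (n.+1%:R^-1 <= gap pt 1 w)%R].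
have mF n : measurable (F n) by exact: measurable_ler_set.
have UF : \bigcup_n F n = setT.
  apply/seteqP; split=> // w _.
  have g0 := gap_gt0 hN 1 w.
  exists (Num.truncn (gap pt 1 w)^-1) => //; rewrite /F/=.
  rewrite -[leRHS]invrK lef_pV2 ?posrE ?invr_gt0// ltW//.
  exact: truncnS_gt.
have nF : {homo F : n m / (n <= m)%N >-> (n <= m)%O}.
  move=> n m nm; apply/subsetPset => w; rewrite /F/=; apply: le_trans.
  by rewrite lef_pV2 ?posrE// ler_nat.
have : P (F n) @[n --> \oo] --> 1.
  have := nondecreasing_cvg_mu mF (bigcup_measurable (fun n _ => mF n)) nF.
  by move/(_ R P); rewrite UF -(@probability_setT _ _ _ P).
move=> /fine_cvgP[_ /cvgrPdist_le/(_ _ e0)[N _ HN]].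
exists (N.+1%:R^-1)%R; first by rewrite invr_gt0.
move=> u' u'N; apply: (@le_trans _ _ (P (F N))).
  have /= := HN N (leqnn N).
  have pf : P (F N) \is a fin_num by exact: fin_num_measure.
  by rewrite -(fineK pf) lee_fin ler_norml => /andP[_]; lra.
apply: le_measure; rewrite ?inE//; first exact: measurable_ler_set.
by move=> w; apply: le_trans.
Qed.

End Limits.

(** * Convergence of occupation averages *)

Section OccupationLimits.
Context {d : measure_display} {Omega : measurableType d} {R : realType}.
Variables (theta : R -> Omega -> Omega) (pt : int -> Omega -> R)
  (P Pbar : probability Omega R).
Hypotheses (htheta : measurable_flow theta) (hN : simple_point_process pt)
  (hshift : shift_compatible pt theta) (hPalm : palm_distribution pt theta P)
  (hPbar : stationary_distribution pt theta P Pbar)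
  (hiii : forall (A : set Omega) (u : R), measurable A -> 0 <= u ->
    Pbar ((theta t @^-1` A) `&` [set w | pt 1 w <= u]) @[t --> +oo] -->
      (Pbar A * Pbar [set w | pt 1 w <= u]%R)%E).
Local Open Scope ereal_scope.
Local Notation leb := (@lebesgue_measure R).
Local Notation GR := (measurableTypeR R).
Local Notation lambda := (intensity pt P).
Local Notation occupation := (occupation theta P).
Implicit Types (a b c k : R) (Z : Omega -> R).

Lemma occupation_indic_fin A a b : measurable A -> (a <= b)%R ->
  occupation a b \1_A \is a fin_num.
Proof.
move=> mA ab; rewrite ge0_fin_numE ?occupation_ge0//.
apply: (@le_lt_trans _ _ (occupation a b (cst 1%R))).
  have mi : measurable_fun setT (\1_A : Omega -> R) by exact: measurable_indic.
  apply: (le_occupation _ htheta _ _ mi) => //.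
  by move=> w; rewrite indicE; case: (_ \in _).
by rewrite occupation_cst// ltry.
Qed.

(** The relative error e fixes how short the window must be. The mixing error e' is chosen after u,
    because it will be summed over a number of windows that depends on u. *)
Lemma occupation_window (A : set Omega) (e : R) : measurable A -> (0 < e)%R ->
  exists2 u0 : R, (0 < u0)%R & forall u, (0 < u <= u0)%R -> forall e', (0 < e')%R ->
    exists t0 : R, forall t, (t0 <= t)%R ->
      (fine (Pbar A) * u * (1 - e) - e')%:E <= occupation (t - u) t \1_A.
Proof.
move=> mA e0; have [u0 u00 hu] := gap_gt_near1 P hN e0.
have l0 := intensity_gt0 hN hPbar.
exists u0 => // u /andP[upos uu0] e' e'0.
(* The factor lambda is divided out of the inequality at the end. *)
have le'0 : (0 < lambda * e')%R by rewrite mulr_gt0.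
have [t0 ht0] := mixing_lower htheta hN hshift hPalm hPbar hiii mA (ltW upos) le'0.
exists t0 => t /ht0.
have pA : Pbar A \is a fin_num by exact: fin_num_measure.
have pU : Pbar [set w | (pt 1 w <= u)%R] \is a fin_num.
  by apply: fin_num_measure; exact: (measurable_pt1_le hN).
have := stationary_pt1_le htheta hN hshift hPalm hPbar (ltW upos).
have := hu _ uu0.
have pG : P [set w | (u <= gap pt 1 w)%R] \is a fin_num.
  by apply: fin_num_measure; apply: measurable_ler_set => //; exact: (measurable_gap hN).
have oF : occupation (t - u) t \1_A \is a fin_num.
  by apply: occupation_indic_fin => //; rewrite gerBl ltW.
rewrite -(fineK pA) -(fineK pU) -(fineK pG) -(fineK oF) -!EFinM -EFinD !lee_fin /=.
have pA0 : (0 <= fine (Pbar A))%R by rewrite fine_ge0.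
set p := fine (Pbar A) in pA0 *; set q := fine (P _); set r := fine (Pbar _).
set o := fine (occupation _ _ _) => h1 h2 h3.
rewrite -(ler_pM2l l0) mulrBr.
have h4 : (p * (lambda * (u * q)) <= p * r)%R by rewrite ler_wpM2l.
have h5 : (p * (lambda * (u * (1 - e))) <= p * (lambda * (u * q)))%R.
  apply: ler_wpM2l => //; apply: ler_wpM2l; first exact: ltW.
  by apply: ler_wpM2l => //; exact: ltW.
lra.
Qed.

(* [a, a + h] is cut into windows short enough for the first gap to exceed
   their length with probability close to one. *)
Lemma occupation_indic_lower (A : set Omega) (h e : R) : measurable A ->
  (0 < h)%R -> (0 < e)%R -> exists a0 : R, forall a, (a0 <= a)%R ->
    h%:E * Pbar A <= occupation a (a + h) \1_A + e%:E.
Proof.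
move=> mA h0 e0.
(* The relative errors add up to at most e / 2 since Pbar(A) <= 1; the m mixing errors e / (2 m)
   make up the other half. *)
have e1 : (0 < e / (2 * h))%R by rewrite divr_gt0// mulr_gt0.
have [u0 u00 hu] := occupation_window mA e1.
pose m := (Num.truncn (h / u0)).+1; pose u : R := (h / m%:R)%R.
have m0 : (0 < m%:R :> R)%R by rewrite ltr0n.
have upos : (0 < u)%R by rewrite divr_gt0.
have uu0 : (u <= u0)%R.
  rewrite /u ler_pdivrMr// -ler_pdivrMl// mulrC ltW//; exact: truncnS_gt.
have e2 : (0 < e / (2 * m%:R))%R by rewrite divr_gt0// mulr_gt0.
have [t0 ht0] := hu u (introT andP (conj upos uu0)) _ e2.
exists t0 => a t0a.
pose c := (fine (Pbar A) * u * (1 - e / (2 * h)) - e / (2 * m%:R))%R.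
have mi : measurable_fun setT (\1_A : Omega -> R) by exact: measurable_indic.
have H (k : nat) : (k%:R * c)%:E <= occupation a (a + k%:R * u) \1_A.
  elim: k => [|k ih]; first by rewrite mul0r occupation_ge0.
  have ku0 : (0 <= k%:R * u)%R by rewrite mulr_ge0// ltW.
  have ek : (a + k.+1%:R * u - u = a + k%:R * u)%R by rewrite -natr1; ring.
  rewrite (occupation_cat _ htheta mi _ (_ : a <= a + k%:R * u)%R)//; last 2 first.
  - by rewrite lerDl.
  - by rewrite -ek gerBl ltW.
  rewrite -natr1 mulrDl mul1r EFinD leeD//.
  rewrite natr1 -ek; apply: ht0; rewrite (le_trans t0a)// lerDl mulr_ge0// ltW//.
have := H m; rewrite (_ : m%:R * u = h)%R; last by rewrite /u mulrC divfK// gt_eqF.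
have pA : Pbar A \is a fin_num by exact: fin_num_measure.
have p1 : (fine (Pbar A) <= 1)%R by rewrite -lee_fin fineK// probability_le1.
have p0 : (0 <= fine (Pbar A))%R by rewrite fine_ge0.
have oF : occupation a (a + h) \1_A \is a fin_num.
  by apply: occupation_indic_fin => //; rewrite lerDl ltW.
rewrite -(fineK pA) -(fineK oF) -EFinM -EFinD !lee_fin => H1.
have mc : (m%:R * c = h * fine (Pbar A) - fine (Pbar A) * (e / 2) - e / 2)%R.
  by rewrite /c /u; field; rewrite !gt_eqF.
have : (fine (Pbar A) * (e / 2) <= e / 2)%R.
  by rewrite -[leRHS]mul1r ler_wpM2r// divr_ge0// ltW.
move: H1; rewrite mc; lra.
Qed.

(** The lower limit, as a tends to infinity, of the occupation of (a, a + h] is at least h times the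
    stationary mean. The form without subtraction makes sense for infinite values. *)
Definition lower_limit (h : R) Z := forall e : R, (0 < e)%R ->
  exists a0 : R, forall a, (a0 <= a)%R ->
    h%:E * \int[Pbar]_w (Z w)%:E <= occupation a (a + h) Z + e%:E.

Lemma lower_limit_scale h k Z : (0 < h)%R -> (0 <= k)%R -> measurable_fun setT Z ->
  (forall w, (0 <= Z w)%R) -> lower_limit h Z -> lower_limit h (fun w => k * Z w)%R.
Proof.
(* The case k = 0 is separate because the error is rescaled to e / k. *)
move=> h0 k0 mZ Z0 LZ e e0; move: k0; rewrite le_eqVlt => /predU1P[<-|k0].
  exists 0%R => a _; rewrite integral0_eq ?mule0; last by move=> w _; rewrite mul0r.
  by rewrite adde_ge0 ?lee_fin ?(ltW e0)// occupation_ge0// => w; rewrite mul0r.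
have [a0 ha0] := LZ (e / k)%R (divr_gt0 e0 k0); exists a0 => a /ha0 H.
rewrite (occupationZ _ htheta)//; last exact: ltW.
under eq_integral do rewrite EFinM.
rewrite ge0_integralZl_EFin//; last 3 first.
- by move=> w _; rewrite lee_fin.
- exact/measurable_EFinP.
- exact: ltW.
rewrite muleCA; apply: (@le_trans _ _ (k%:E * (occupation a (a + h) Z + (e / k)%:E))).
  by rewrite lee_pmul2l.
rewrite ge0_muleDr ?occupation_ge0 ?lee_fin ?divr_ge0 ?(ltW e0) ?(ltW k0)//.
by rewrite -EFinM mulrC divfK// gt_eqF.
Qed.

Lemma lower_limit_add h Z1 Z2 : (0 < h)%R ->
  measurable_fun setT Z1 -> (forall w, (0 <= Z1 w)%R) ->
  measurable_fun setT Z2 -> (forall w, (0 <= Z2 w)%R) ->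
  lower_limit h Z1 -> lower_limit h Z2 -> lower_limit h (fun w => Z1 w + Z2 w)%R.
Proof.
move=> h0 m1 p1 m2 p2 L1 L2 e e0.
have e2 : (0 < e / 2)%R by rewrite divr_gt0.
have [a1 H1] := L1 _ e2; have [a2 H2] := L2 _ e2.
exists (Num.max a1 a2) => a; rewrite ge_max => /andP[/H1 {}H1 /H2 {}H2].
rewrite (occupationD _ htheta)//.
under eq_integral do rewrite EFinD.
rewrite ge0_integralD//; last 4 first.
- by move=> w _; rewrite lee_fin.
- exact/measurable_EFinP.
- by move=> w _; rewrite lee_fin.
- exact/measurable_EFinP.
rewrite ge0_muleDr; last 2 first.
- by apply: integral_ge0 => w _; rewrite lee_fin.
- by apply: integral_ge0 => w _; rewrite lee_fin.
rewrite (_ : e%:E = (e / 2)%:E + (e / 2)%:E); last by rewrite -EFinD -splitr.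
by rewrite addeACA; exact: leeD.
Qed.

Lemma lower_limit_sum h (s : seq R) (A : R -> set Omega) : (0 < h)%R ->
  (forall x, measurable (A x)) -> (forall x, x \in s -> (0 <= x)%R) ->
  lower_limit h (fun w => \sum_(x <- s) x * \1_(A x) w)%R.
Proof.
move=> h0 mA; elim: s => [|x s ih] s0.
  move=> e e0; exists 0%R => a _; rewrite integral0_eq ?mule0; last first.
    by move=> w _; rewrite big_nil.
  by rewrite adde_ge0 ?lee_fin ?(ltW e0)// occupation_ge0// => w; rewrite big_nil.
have mi y : measurable_fun setT (\1_(A y) : Omega -> R) by exact: measurable_indic.
have x0 : (0 <= x)%R by rewrite s0// mem_head.
have s0' y : y \in s -> (0 <= y)%R by move=> ys; rewrite s0// in_cons ys orbT.
rewrite (_ : (fun _ => _) = fun w => (x * \1_(A x) w + \sum_(y <- s) y * \1_(A y) w)%R).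
  apply: lower_limit_add => //.
  - exact: measurable_funM.
  - by move=> w; rewrite mulr_ge0.
  - by apply: measurable_sum => y; exact: measurable_funM.
  - by move=> w; rewrite big_seq sumr_ge0// => y ys; rewrite mulr_ge0// s0'.
  - apply: lower_limit_scale => // e e0.
    by have := occupation_indic_lower (mA x) h0 e0; rewrite integral_indic// setIT.
  - exact: ih.
by apply/funext => w; rewrite big_cons.
Qed.

Import HBNNSimple.

(** A lower bound survives approximation from below: a simple function f <= Z with nearly the same
    stationary mean has the bound, and its occupation is at most that of Z. *)
Lemma lower_limit_ge0 h Z : (0 < h)%R -> measurable_fun setT Z ->
  (forall w, (0 <= Z w)%R) -> \int[Pbar]_w (Z w)%:E < +oo -> lower_limit h Z.
Proof.
move=> h0 mZ Z0 Zoo e e0.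
have e2 : (0 < e / 2)%R by rewrite divr_gt0.
have eh : (0 < e / 2 / h)%R by rewrite divr_gt0.
have Zf : \int[Pbar]_w (Z w)%:E \is a fin_num.
  by rewrite ge0_fin_numE// integral_ge0// => w _; rewrite lee_fin.
have [f fZ If] : exists2 f : {nnsfun Omega >-> R}, (forall w, (f w <= Z w)%R) &
    \int[Pbar]_w (Z w)%:E <= \int[Pbar]_w (f w)%:E + (e / 2 / h)%:E.
  (* Strict because the mean is finite; hence some simple function in the supremum that defines the
     integral lies above the left side. *)
  have : \int[Pbar]_w (Z w)%:E - (e / 2 / h)%:E < \int[Pbar]_w (Z w)%:E.
    by rewrite lteBlDr// lteDl// lte_fin.
  rewrite {2}ge0_integralTE; last by move=> w; rewrite lee_fin.
  move=> /ereal_sup_gt[_ [f fZ <-]] /ltW; rewrite leeBlDr// => H.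
  by exists f; [move=> w; have := fZ w; rewrite lee_fin|rewrite integralT_nnsfun].
have Lf : lower_limit h f.
  rewrite (_ : (f : Omega -> R) = fun w =>
      (\sum_(x <- finmap.enum_fset (fset_set (range f))) x * \1_(f @^-1` [set x]) w)%R).
    apply: lower_limit_sum => // x; rewrite in_fset_set// inE => -[w _ <-].
    exact: fun_ge0.
  apply/funext => w; rewrite {1}(fimfunE f w) fsbig_finite//.
have [a0 H] := Lf _ e2; exists a0 => a /H {}H.
apply: (@le_trans _ _ (h%:E * (\int[Pbar]_w (f w)%:E + (e / 2 / h)%:E))).
  by rewrite lee_pmul2l.
rewrite ge0_muleDr; last 2 first.
- by apply: integral_ge0 => w _; rewrite lee_fin.
- by rewrite lee_fin ltW.
rewrite -EFinM (_ : h * (e / 2 / h) = e / 2)%R; last by rewrite mulrC divfK// gt_eqF.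
apply: (@le_trans _ _ (occupation a (a + h) f + (e / 2)%:E + (e / 2)%:E)).
  by rewrite leeD2r.
rewrite -addeA -EFinD -splitr leeD2r//.
by apply: (le_occupation _ htheta).
Qed.

(** The lower bound is applied to C - Z: the occupations of Z and C - Z sum to exactly C h, and
    their stationary means to C. *)
Lemma bounded_upper h C Z e : (0 < h)%R -> measurable_fun setT Z ->
  (forall w, (0 <= Z w <= C)%R) -> (0 < e)%R ->
  exists a0 : R, forall a, (a0 <= a)%R ->
    occupation a (a + h) Z <= h%:E * \int[Pbar]_w (Z w)%:E + e%:E.
Proof.
move=> h0 mZ ZC e0.
have Z0 w : (0 <= Z w)%R by have /andP[] := ZC w.
have C0 : (0 <= C)%R by have /andP[/le_trans] := ZC point; apply.
pose V w := (C - Z w)%R.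
have mV : measurable_fun setT V by exact: measurable_funB.
have V0 w : (0 <= V w)%R by rewrite subr_ge0; have /andP[] := ZC w.
have VZ : \int[Pbar]_w (V w)%:E + \int[Pbar]_w (Z w)%:E = C%:E.
  rewrite -ge0_integralD//; last 4 first.
  - by move=> w _; rewrite lee_fin.
  - exact/measurable_EFinP.
  - by move=> w _; rewrite lee_fin.
  - exact/measurable_EFinP.
  transitivity (\int[Pbar]_w (cst C%:E w)).
    by apply: eq_integral => w _; rewrite -EFinD subrK.
  by rewrite integral_cst// [X in _ * X](_ : _ = 1) ?mule1//; exact: probability_setT.
have Vi0 : 0 <= \int[Pbar]_w (V w)%:E by apply: integral_ge0 => w _; rewrite lee_fin.
have Zi0 : 0 <= \int[Pbar]_w (Z w)%:E by apply: integral_ge0 => w _; rewrite lee_fin.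
have Voo : \int[Pbar]_w (V w)%:E < +oo.
  by rewrite (@le_lt_trans _ _ C%:E) ?ltry// -VZ leeDl.
have Zoo : \int[Pbar]_w (Z w)%:E < +oo.
  by rewrite (@le_lt_trans _ _ C%:E) ?ltry// -VZ leeDr.
have [a0 H] := lower_limit_ge0 h0 mV V0 Voo e0.
exists a0 => a /H {}H.
have oVZ : occupation a (a + h) V + occupation a (a + h) Z = (C * h)%:E.
  rewrite -(occupationD _ htheta)// (_ : (fun _ => _) = cst C).
    by rewrite occupation_cst ?lerDl ?(ltW h0)// addrAC subrr add0r.
  by apply/funext => w /=; rewrite subrK.
have oV0 : 0 <= occupation a (a + h) V by exact: occupation_ge0.
have oZ0 : 0 <= occupation a (a + h) Z by exact: occupation_ge0.
have oVf : occupation a (a + h) V \is a fin_num.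
  by rewrite ge0_fin_numE// (@le_lt_trans _ _ (C * h)%:E) ?ltry// -oVZ leeDl.
have oZf : occupation a (a + h) Z \is a fin_num.
  by rewrite ge0_fin_numE// (@le_lt_trans _ _ (C * h)%:E) ?ltry// -oVZ leeDr.
have Vf : \int[Pbar]_w (V w)%:E \is a fin_num by rewrite ge0_fin_numE.
have Zf : \int[Pbar]_w (Z w)%:E \is a fin_num by rewrite ge0_fin_numE.
move: H oVZ VZ; rewrite -(fineK oVf) -(fineK oZf) -(fineK Vf) -(fineK Zf).
rewrite -!EFinM -!EFinD !lee_fin => H [oVZ] [VZ].
by move: H; rewrite -VZ in oVZ; nra.
Qed.

End OccupationLimits.

(** * The age density *)

Section Intensity.
Context {d : measure_display} {Omega : measurableType d} {R : realType}.
Variables (theta : R -> Omega -> Omega) (pt : int -> Omega -> R)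
  (P Pbar : probability Omega R).
Hypotheses (htheta : measurable_flow theta) (hN : simple_point_process pt)
  (hshift : shift_compatible pt theta) (hPalm : palm_distribution pt theta P)
  (hPbar : stationary_distribution pt theta P Pbar).
Variables (v : R) (gv : (nat -> R) -> R).
Hypotheses (v0 : (0 < v)%R) (hgv : truncated_mean_version pt P v gv).
Local Open Scope ereal_scope.
Local Notation leb := (@lebesgue_measure R).
Local Notation GR := (measurableTypeR R).
Local Notation lambda := (intensity pt P).
Local Notation occupation := (occupation theta P).
Local Notation ratio := (gap_ratio pt v gv).

(** The value of [lambda_tilde] at time 0. *)
Definition inverse_mean (w : Omega) : R := (gv (past_gaps pt 0 w))^-1.

Lemma inverse_mean_gt0 w : (0 < inverse_mean w)%R.
Proof. by rewrite invr_gt0; exact: (gv_gt0 hgv). Qed.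

Lemma measurable_inverse_mean : measurable_fun setT inverse_mean.
Proof.
by apply: measurable_funV; [exact: (measurable_gv v0 hgv 0)|move=> w; exact: (gv_gt0 hgv)].
Qed.

Lemma inverse_mean_shift (n : int) w s : (pt n w <= s < pt (n + 1)%R w)%R ->
  inverse_mean (theta s w) = (gv (past_gaps pt n w))^-1%R.
Proof. by move=> sn; rewrite /inverse_mean (past_gaps_shift hN hshift sn). Qed.

Lemma palm_cell w s : palm_zero pt w -> (0 <= s < gap pt 1 w)%R ->
  (pt 0 w <= s < pt (0 + 1)%R w)%R.
Proof. by rewrite /palm_zero/= /gap subrr => ->; rewrite subr0 add0r. Qed.

Lemma gap_ratio0_mean : \int[P]_w (ratio 0 w)%:E = 1.
Proof.
rewrite (gap_ratio_mean htheta hN hshift v0 hgv (n := 0)); last first.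
  exact: (@measurableT _ (g_sigma_algebraType _)).
exact: probability_setT.
Qed.

(** Palm inversion leaves lambda times the mean of the gap ratio, which is one. It serves both the
    intensity formula and the age density. *)
Lemma stationary_intensity (F : Omega -> R) : measurable_fun setT F ->
  (forall w, (0 <= F w)%R) ->
  (forall w, palm_zero pt w ->
    \int[leb]_(s in `[0%R, gap pt 1 w]) (F (theta s w))%:E = (ratio 0 w)%:E) ->
  \int[Pbar]_w (F w)%:E = lambda%:E.
Proof.
move=> mF F0 FG.
rewrite (stationary_cycle htheta hN hPalm hPbar mF F0 _ _ FG).
- by rewrite gap_ratio0_mean mule1.
- exact: (measurable_gap_ratio hN v0 hgv 0).
- by move=> w; exact: (gap_ratio_ge0 hN v0 hgv).
Qed.

Lemma stationary_residual :
  \int[Pbar]_w (inverse_mean w * \1_[set w' | (pt 1 w' <= v)%R] w)%:E = lambda%:E.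
Proof.
have mi : measurable_fun setT (\1_[set w' | (pt 1 w' <= v)%R] : Omega -> R).
  by apply: measurable_indic; exact: (measurable_pt1_le hN).
have mF : measurable_fun setT (fun w => inverse_mean w * \1_[set w' | (pt 1 w' <= v)%R] w)%R.
  by apply: measurable_funM => //; exact: measurable_inverse_mean.
apply: stationary_intensity => // [w|w w0].
  by rewrite mulr_ge0// ltW// inverse_mean_gt0.
rewrite (residual_cell htheta hN hshift mF w0 (ltW (inverse_mean_gt0 w)) (ltW v0)).
  by rewrite mulrC /gap_ratio add0r.
move=> s s0; rewrite (inverse_mean_shift (palm_cell w0 s0)) /inverse_mean.
by [].
Qed.

(* The indicator confines the mass to the first delta units of time after a
   point; the quotient makes the total mass of a gap a multiple of
   min(gap, v) while keeping the factor bounded by 1 + v / delta. *)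
Definition age_factor (delta : R) (w : Omega) : R :=
  \1_[set w' | (- pt 0 w' < delta)%R] w *
    (Num.min (gap pt 1 w) v / Num.min (gap pt 1 w) delta).

Variable delta : R.
Hypothesis delta0 : (0 < delta)%R.

Lemma min_gap_gt0 n w (u : R) : (0 < u)%R -> (0 < Num.min (gap pt n w) u)%R.
Proof. by move=> u0; rewrite lt_min (gap_gt0 hN). Qed.

Lemma measurable_age_factor : measurable_fun setT (age_factor delta).
Proof.
have mg := measurable_gap hN 1.
apply: measurable_funM.
  apply: measurable_indic; apply: measurable_ltr_set => //.
  by apply: measurable_funN; exact: (measurable_pt hN).
apply: measurable_funM; first exact: measurable_minr.
by apply: measurable_funV; [exact: measurable_minr|move=> w; exact: min_gap_gt0].
Qed.

(** If T_1 <= delta the quotient is at most 1; otherwise its denominator is delta and it is at most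
    v / delta. *)
Lemma age_factor_bound w : (0 <= age_factor delta w <= 1 + v / delta)%R.
Proof.
have g0 := gap_gt0 hN 1 w.
have r0 : (0 <= Num.min (gap pt 1 w) v / Num.min (gap pt 1 w) delta)%R.
  by rewrite divr_ge0// ltW// min_gap_gt0.
have i1 : (\1_[set w' | (- pt 0 w' < delta)%R] w <= 1 :> R)%R.
  by rewrite indicE; case: (_ \in _).
have vd : (0 <= v / delta)%R by rewrite divr_ge0// ltW.
rewrite /age_factor mulr_ge0//=.
apply: (@le_trans _ _ (Num.min (gap pt 1 w) v / Num.min (gap pt 1 w) delta)%R).
  by rewrite ler_piMl.
rewrite ler_pdivrMr ?min_gap_gt0//.
have [gd|dg] := leP (gap pt 1 w) delta.
  apply: (@le_trans _ _ (gap pt 1 w)); first by rewrite ge_min lexx.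
  by rewrite mulrDl mul1r lerDl mulr_ge0// ltW.
apply: (@le_trans _ _ v); first by rewrite ge_min lexx orbT.
by rewrite mulrDl mul1r divfK ?gt_eqF// lerDr ltW.
Qed.

Definition age_density (w : Omega) : R := inverse_mean w * age_factor delta w.

Lemma measurable_age_density : measurable_fun setT age_density.
Proof.
by apply: measurable_funM; [exact: measurable_inverse_mean|exact: measurable_age_factor].
Qed.

Lemma age_density_ge0 w : (0 <= age_density w)%R.
Proof.
by rewrite mulr_ge0 ?(ltW (inverse_mean_gt0 _))//; have /andP[] := age_factor_bound w.
Qed.

(** On each cell the density spreads the gap ratio uniformly over the first min(T_(n+1), delta)
    units of time. *)
Lemma age_density_shift (n : int) w s : (pt n w <= s < pt (n + 1)%R w)%R ->
  age_density (theta s w) =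
    (ratio n w / Num.min (gap pt (n + 1)%R w) delta * \1_`]-oo, (pt n w + delta)%R[ s)%R.
Proof.
move=> sn; rewrite /age_density /age_factor (inverse_mean_shift sn).
rewrite !(gap_shift hN hshift sn) [(1 + n)%R]addrC /gap_ratio.
rewrite (_ : \1_[set w' | (- pt 0 w' < delta)%R] (theta s w) =
    \1_`]-oo, (pt n w + delta)%R[ s :> R).
  by ring.
rewrite !indicE; congr ((nat_of_bool _)%:R)%R.
by apply/idP/idP; rewrite !inE/= in_itv/= (pt_shift hN hshift sn) add0r; lra.
Qed.

Lemma stationary_age : \int[Pbar]_w (age_density w)%:E = lambda%:E.
Proof.
apply: stationary_intensity.
- exact: measurable_age_density.
- exact: age_density_ge0.
move=> w w0; have m0 := min_gap_gt0 1 w delta0.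
rewrite (age_cell htheta hN (k := ratio 0 w / Num.min (gap pt 1 w) delta) (u := delta)).
- by rewrite divfK ?gt_eqF.
- exact: measurable_age_density.
- by rewrite divr_ge0 ?(ltW m0)//; exact: (gap_ratio_ge0 hN v0 hgv).
- exact: ltW.
- move=> s s0; rewrite (age_density_shift (palm_cell w0 s0)).
  by move: w0; rewrite /palm_zero/= => ->; rewrite !add0r.
Qed.

Hypothesis hui : uniformly_integrable P [set t : R | (0 <= t)%R] (lambda_tilde pt gv).
Hypothesis hiii : forall (A : set Omega) (u : R), measurable A -> (0 <= u)%R ->
    Pbar ((theta t @^-1` A) `&` [set w | pt 1 w <= u]%R) @[t --> +oo%R] -->
      (Pbar A * Pbar [set w | pt 1 w <= u]%R)%E.

Lemma age_density_lower (h e : R) : (0 < h)%R -> (0 < e)%R ->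
  exists a0 : R, forall a, (a0 <= a)%R ->
    (lambda * h - e)%:E <= occupation a (a + h) age_density.
Proof.
move=> h0 e0.
have [a0 H] := lower_limit_ge0 htheta hN hshift hPalm hPbar hiii h0
  measurable_age_density age_density_ge0 (eq_ind_r (fun x => x < +oo) (ltry _) stationary_age) e0.
exists a0 => a /H; rewrite stationary_age -EFinM => {}H.
by rewrite EFinB leeBlDr// mulrC.
Qed.

(** The density is split according to the size of [inverse_mean]. Where this is at most K the
    density is bounded and [bounded_upper] applies; the rest is at most C times a tail controlled by
    uniform integrability. *)
Lemma age_density_upper (h e : R) : (0 < h)%R -> (0 < e)%R ->
  exists a0 : R, forall a, (a0 <= a)%R ->
    occupation a (a + h) age_density <= (lambda * h + e)%:E.
Proof.
move=> h0 e0.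
have C0 : (0 < 1 + v / delta)%R by rewrite addr_gt0// divr_gt0.
set C := (1 + v / delta)%R in C0.
(* Chosen so that a tail of this size, integrated over length h and multiplied by C, gives e / 2. *)
have e1 : (0 < e / 2 / (C * h))%R by rewrite !divr_gt0// mulr_gt0.
have e2 : (0 < e / 2)%R by rewrite divr_gt0.
have [K HK] := (proj2 hui) _ e1.
pose Z1 w := Num.min (age_density w) (`|K| * C)%R.
pose Z2 w := (inverse_mean w * \1_[set w' | (K < inverse_mean w')%R] w)%R.
have mL := measurable_inverse_mean.
have mi : measurable_fun setT (\1_[set w' | (K < inverse_mean w')%R] : Omega -> R).
  by apply: measurable_indic; exact: measurable_ltr_set.
have mZ1 : measurable_fun setT Z1.
  by apply: measurable_minr => //; exact: measurable_age_density.
have mZ2 : measurable_fun setT Z2 by exact: measurable_funM.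
have Z1b w : (0 <= Z1 w <= `|K| * C)%R.
  by rewrite le_min age_density_ge0 mulr_ge0 ?(ltW C0)//= ge_min lexx orbT.
have Z10 w : (0 <= Z1 w)%R by have /andP[] := Z1b w.
have Z20 w : (0 <= Z2 w)%R by rewrite mulr_ge0// ltW// inverse_mean_gt0.
have Zle w : (age_density w <= Z1 w + C * Z2 w)%R.
  have /andP[b0 bC] := age_factor_bound w.
  have [KL|LK] := ltP K (inverse_mean w).
    apply: (@le_trans _ _ (C * Z2 w)%R); last by rewrite lerDr.
    rewrite /Z2 indicE mem_set//= mulr1 /age_density mulrC.
    by apply: ler_wpM2r => //; exact/ltW/inverse_mean_gt0.
  apply: (@le_trans _ _ (Z1 w)); last by rewrite lerDl mulr_ge0// ltW.
  rewrite le_min lexx/= /age_density; apply: ler_pM => //.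
  - exact/ltW/inverse_mean_gt0.
  - exact: le_trans LK (ler_norm _).
have [a0 H1] := bounded_upper htheta hN hshift hPalm hPbar hiii h0 mZ1 Z1b e2.
(* The maximum with 0 keeps the window in the range t >= 0 of the uniform integrability
   hypothesis. *)
exists (Num.max 0 a0)%R => a; rewrite ge_max => /andP[a00 /H1 {}H1].
have ah : (a <= a + h)%R by rewrite lerDl ltW.
have o1 : occupation a (a + h) Z1 <= (lambda * h + e / 2)%:E.
  apply: (le_trans H1); rewrite EFinD; apply: leeD2r; rewrite mulrC EFinM lee_pmul2l//.
  rewrite -stationary_age; apply: ge0_le_integral => //.
  - by move=> w _; rewrite lee_fin.
  - exact/measurable_EFinP.
  - by apply/measurable_EFinP; exact: measurable_age_density.
  - by move=> w _; rewrite lee_fin ge_min lexx.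
have o2 : occupation a (a + h) Z2 <= (e / 2 / (C * h) * h)%:E.
  (* With time outermost, the tail bound applies to the inner integral at each t. *)
  rewrite (occupationE2 _ htheta)//.
  apply: (@le_trans _ _ (\int[leb]_(t in `]a, (a + h)%R]) (cst (e / 2 / (C * h))%:E t))).
    apply: ge0_le_integral => //.
    - by move=> t _; apply: integral_ge0 => w _; rewrite lee_fin.
    - pose Z2f := fun z : Omega * GR => (Z2 (theta z.2 z.1))%:E.
      apply: measurable_funTS.
      apply: (@measurable_fun_fubini_tonelli_G _ _ _ _ _ P Z2f).
        exact: (measurable_flow_fun htheta mZ2).
      by move=> z; rewrite lee_fin.
    - move=> t; rewrite /= in_itv/= => /andP[ta _].
      apply: le_trans (HK t _); last by rewrite /= (le_trans a00)// ltW.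
      rewrite [leRHS]integral_mkcond le_eqVlt; apply/orP; left; apply/eqP.
      apply: eq_integral => w _; rewrite patchE /Z2 (lambda_tilde_shift hN hshift).
      rewrite -/(inverse_mean _) !gtr0_norm ?inverse_mean_gt0// indicE.
      case: (boolP (w \in _)); rewrite ?inE ?notin_setE/=;
        rewrite (lambda_tilde_shift hN hshift) -/(inverse_mean _)
          gtr0_norm ?inverse_mean_gt0// => KL.
        by rewrite mem_set// mulr1.
      by rewrite memNset// mulr0.
  rewrite integral_cst//.
  rewrite [X in _ * X](_ : _ = h%:E) ?EFinM//.
  transitivity (leb (`]a, (a + h)%R]%classic : set R)) => //.
  by rewrite lebesgue_measure_itv/= lte_fin ltrDl h0 -EFinB addrAC subrr add0r.
apply: (@le_trans _ _ (occupation a (a + h) (fun w => Z1 w + C * Z2 w)%R)).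
  by apply: (le_occupation _ htheta) => //; [exact: measurable_age_density|
    apply: measurable_funD => //; exact: measurable_funM|exact: age_density_ge0].
rewrite (occupationD _ htheta)//; last 2 first.
- exact: measurable_funM.
- by move=> w; rewrite mulr_ge0// ltW.
rewrite (occupationZ _ htheta)//; last exact: ltW.
apply: (le_trans (leeD o1 (_ : _ <= C%:E * (e / 2 / (C * h) * h)%:E))).
  by rewrite lee_pmul2l.
rewrite -EFinM -EFinD lee_fin.
rewrite (_ : C * (e / 2 / (C * h) * h) = e / 2)%R; last by field; rewrite !gt_eqF.
lra.
Qed.

End Intensity.

(** * Counting points *)

Section Counting.
Context {d : measure_display} {Omega : measurableType d} {R : realType}.
Variables (theta : R -> Omega -> Omega) (pt : int -> Omega -> R)
  (P : probability Omega R).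
Hypotheses (htheta : measurable_flow theta) (hN : simple_point_process pt)
  (hshift : shift_compatible pt theta) (hPalm : palm_distribution pt theta P).
Local Open Scope ereal_scope.
Local Notation leb := (@lebesgue_measure R).
Local Notation GR := (measurableTypeR R).
Local Notation occupation := (occupation theta P).

Definition crossing (n : nat) (a b : R) : set Omega := [set w | (a < pt n%:Z w <= b)%R].

(** For a >= 0 this is the mean number of points in (a, b], because points of negative index lie
    below 0. *)
Definition crossings (a b : R) : \bar R := \sum_(n <oo) P (crossing n a b).

Lemma measurable_crossing n a b : measurable (crossing n a b).
Proof. by apply: (strict_past_measurable htheta hN hshift); exact: strict_past_interval. Qed.

Lemma crossings_ge0 a b : 0 <= crossings a b.
Proof. by apply: nneseries_ge0 => n _ _. Qed.

Lemma mean_count_series t :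
  mean_count pt P t = \sum_(n <oo) P [set w | (0 <= pt n%:Z w <= t)%R].
Proof.
have mI (n : nat) : measurable [set w | (0 <= pt n%:Z w <= t)%R].
  rewrite (_ : [set w | _] = [set w | (0 <= pt n%:Z w)%R] `&` [set w | (pt n%:Z w <= t)%R]).
    by apply: measurableI; apply: measurable_ler_set => //; exact: (measurable_pt hN).
  by apply/seteqP; split=> w /=; [move=> /andP[]|move=> [? ?]; apply/andP].
have pcE w : point_count pt `[0%R, t] w =
    \sum_(n <oo) (\1_[set w | (0 <= pt n%:Z w <= t)%R] w)%:E.
  rewrite nneseries_esumT//.
  (* Negative indices contribute nothing, since their points lie strictly before t_0 <= 0. *)
  rewrite /point_count (esumID (range Posz)); last by move=> n _; rewrite lee_fin.
  rewrite [X in _ + X]esum1 ?adde0; last first.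
    move=> [n [_ nr]|n _]; first by exfalso; apply: nr; exists n.
    rewrite indicE memNset//= in_itv/= => /andP[+ _].
    rewrite leNgt => /negP; apply; apply: lt_le_trans (pt0_le0 hN w).
    by rewrite (ltr_pt hN).
  rewrite setTI esum_image; last by move=> ? ? _ _ [].
  apply: eq_esum => n _; rewrite !indicE.
  rewrite (_ : (_ \in `[0%R, t]%classic) = (w \in [set w | (0 <= pt n%:Z w <= t)%R]))//.
rewrite /mean_count (eq_integral _ _ (fun w _ => pcE w)) integral_nneseries//.
- by apply: eq_eseriesr => n _; rewrite integral_indic// setIT.
- by move=> n; apply/measurable_EFinP; exact: measurable_indic.
Qed.

Lemma mean_count_crossings a b : (0 <= a)%R -> (a <= b)%R ->
  mean_count pt P b = mean_count pt P a + crossings a b.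
Proof.
move=> a0 ab; rewrite !mean_count_series /crossings -nneseriesD//.
apply: eq_eseriesr => n _; rewrite -measureU//.
- congr (P _); apply/seteqP; split => w /=.
    move=> /andP[p0 pb]; rewrite /crossing/= p0 pb/= andbT.
    by case: (leP (pt n%:Z w) a); [left|right].
  move=> []/andP[p0 pb]; apply/andP; split => //.
    exact: le_trans pb ab.
  by apply: ltW; apply: le_lt_trans p0.
- rewrite (_ : [set w | _] = [set w | (0 <= pt n%:Z w)%R] `&` [set w | (pt n%:Z w <= a)%R]).
    by apply: measurableI; apply: measurable_ler_set => //; exact: (measurable_pt hN).
  by apply/seteqP; split=> w /=; [move=> /andP[]|move=> [? ?]; apply/andP].
- exact: measurable_crossing.
- apply/seteqP; split => // w [/= /andP[_ pa] /andP[ap _]].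
  by move: (le_lt_trans pa ap); rewrite ltxx.
Qed.

Variables (v : R) (gv : (nat -> R) -> R) (delta : R).
Hypotheses (v0 : (0 < v)%R) (hgv : truncated_mean_version pt P v gv)
  (delta0 : (0 < delta)%R).
Local Notation ratio := (gap_ratio pt v gv).
Local Notation density := (age_density pt v gv delta).

Definition weighted_crossings (a b : R) (w : Omega) : \bar R :=
  \sum_(n <oo) (ratio n%:Z w * \1_(crossing n a b) w)%:E.

Lemma weight_ge0 n a b w : 0 <= (ratio n%:Z w * \1_(crossing n a b) w)%:E.
Proof. by rewrite lee_fin mulr_ge0//; exact: (gap_ratio_ge0 hN v0 hgv). Qed.

Lemma measurable_weight n a b :
  measurable_fun setT (fun w => (ratio n%:Z w * \1_(crossing n a b) w)%:E).
Proof.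
apply/measurable_EFinP; apply: measurable_funM.
  exact: (measurable_gap_ratio hN v0 hgv).
by apply: measurable_indic; exact: measurable_crossing.
Qed.

Lemma measurable_weighted_crossings a b : measurable_fun setT (weighted_crossings a b).
Proof.
apply: ge0_emeasurable_sum => n *; [exact: weight_ge0|exact: measurable_weight].
Qed.

Lemma weighted_crossings_ge0 a b w : 0 <= weighted_crossings a b w.
Proof. by apply: nneseries_ge0 => n _ _; exact: weight_ge0. Qed.

(** Each crossing event belongs to the strict past of its point, so there the gap ratio integrates
    to the probability of the event. *)
Lemma integral_weighted_crossings a b :
  \int[P]_w weighted_crossings a b w = crossings a b.
Proof.
rewrite integral_nneseries//; last 2 first.
- by move=> n; exact: measurable_weight.
- by move=> n w _; exact: weight_ge0.
apply: eq_eseriesr => n _.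
rewrite -(gap_ratio_mean htheta hN hshift v0 hgv (@strict_past_interval _ _ _ pt n%:Z a b)).
rewrite [RHS]integral_mkcond; apply: eq_integral => w _.
rewrite patchE indicE -/(crossing n a b).
by case: ifPn => _; rewrite ?mulr1 ?mulr0.
Qed.

(** The interval is partitioned by the cells between consecutive points, and in each cell only the
    initial stretch carries density. *)
Lemma density_cells a b w : palm_zero pt w -> (0 <= a)%R ->
  \int[leb]_(t in `]a, b]) (density (theta t w))%:E =
  \sum_(n <oo) (ratio n%:Z w / Num.min (gap pt (n%:Z + 1)%R w) delta)%:E *
    leb (`]a, b]%classic `&`
      `[pt n%:Z w, (pt n%:Z w + Num.min (gap pt (n%:Z + 1)%R w) delta)%R[%classic).
Proof.
move=> w0 a0.
pose F n : set GR := `]a, b]%classic `&` `[pt n%:Z w, pt (n%:Z + 1)%R w[%classic.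
have mF n : measurable (F n) by apply: measurableI; exact: measurable_itv.
have UF : `]a, b]%classic = \bigcup_n F n.
  apply/seteqP; split => t; last by move=> [n _ []].
  move=> tab; have [[n|n] tn] := pt_cell hN t w.
    by exists n => //; split => //; rewrite /= in_itv.
  (* A cell of negative index ends at or before t_0 = 0, hence cannot contain a time beyond a. *)
  move: tab; rewrite /= in_itv/= => /andP[a_t _]; exfalso.
  have : (pt (Negz n + 1)%R w <= pt 0 w)%R by rewrite (ler_pt hN); lia.
  rewrite w0; case/andP: tn => _ tn /(lt_le_trans tn) /(lt_trans a_t).
  by rewrite ltNge a0.
have md : measurable_fun setT (fun t : GR => (density (theta t w))%:E : \bar R).
  apply/measurable_EFinP.
  exact: (measurableT_comp (measurable_age_density hN v0 hgv delta0) (measurable_path htheta w)).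
have d0 t : 0 <= (density (theta t w))%:E.
  by rewrite lee_fin; exact: (age_density_ge0 hN v0 hgv delta0).
rewrite [in LHS]UF ge0_integral_bigcup//; last 2 first.
- exact: measurable_funTS.
- apply/trivIsetP => i j _ _; apply: contraNeq => /set0P[t []].
  rewrite /F /= !in_itv/= => -[_ ti] [_ tj].
  by have [/eqP] := pt_cell_unique hN ti tj.
apply: eq_eseriesr => n _.
set k := (_ / _)%R; set x := pt n%:Z w; set m := Num.min _ _.
transitivity (\int[leb]_(t in F n) (k%:E * (\1_`]-oo, (x + delta)%R[ t)%:E)).
  apply: eq_integral => t; rewrite inE => -[_]; rewrite /= in_itv/= => tn.
  by rewrite (age_density_shift hN hshift _ _ _ tn) EFinM.
have k0 : (0 <= k)%R.
  by rewrite divr_ge0 ?(gap_ratio_ge0 hN v0 hgv)// ltW// (min_gap_gt0 hN).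
rewrite ge0_integralZl_EFin//; last first.
  by apply/measurable_funTS/measurable_EFinP; exact: measurable_indic.
rewrite integral_indic//; congr (_ * leb _).
have gE : (pt (n%:Z + 1)%R w = x + gap pt (n%:Z + 1)%R w)%R.
  by rewrite /gap addrK -/x; ring.
apply/seteqP; split => t; rewrite /F/= !in_itv/= gE.
  move=> [td [-> /andP[-> tg]]]; split => //=.
  by rewrite /m addr_minr lt_min tg td.
move=> [-> /andP[->]]; rewrite /m addr_minr lt_min => /andP[-> ->].
by [].
Qed.

(** Mass is displaced forward by less than delta, so whatever falls in (a, b] comes from points in
    (a - delta, b]. *)
Lemma density_le_crossings a b w : palm_zero pt w -> (0 <= a)%R ->
  \int[leb]_(t in `]a, b]) (density (theta t w))%:E <= weighted_crossings (a - delta) b w.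
Proof.
move=> w0 a0; rewrite density_cells//; apply: lee_nneseries => [n _ _|n _].
  rewrite mule_ge0// lee_fin divr_ge0 ?(gap_ratio_ge0 hN v0 hgv)// ltW//.
  exact: (min_gap_gt0 hN).
set x := pt n%:Z w; set m := Num.min _ _.
have m0 : (0 < m)%R by exact: (min_gap_gt0 hN).
have md : (m <= delta)%R by rewrite ge_min lexx orbT.
have r0 : (0 <= ratio n%:Z w)%R by exact: (gap_ratio_ge0 hN v0 hgv).
have rm : (ratio n%:Z w = ratio n%:Z w / m * m)%R by rewrite divfK// gt_eqF.
set q := (ratio n%:Z w / m)%R in rm *.
have q0 : (0 <= q)%R by rewrite divr_ge0// ltW.
rewrite indicE; case: (boolP (w \in _)); rewrite ?inE ?notin_setE/= /crossing/= -/x => xab.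
  rewrite mulr1 rm [leRHS]EFinM; apply: lee_wpmul2l; first by rewrite lee_fin.
  apply: (@le_trans _ _ (leb (`[x, (x + m)%R[%classic : set R))).
    apply: le_measure; rewrite ?inE; try exact: measurable_itv.
      by apply: measurableI; exact: measurable_itv.
    exact: subIsetr.
  by rewrite lebesgue_measure_itv/= lte_fin ltrDl m0 -EFinB addrAC subrr add0r.
rewrite mulr0 (_ : _ `&` _ = set0) ?measure0 ?mule0//.
apply/seteqP; split => // t [/=]; rewrite !in_itv/= => /andP[a_t t_b] /andP[xt tx].
apply: xab; apply/andP; split; lra.
Qed.

(** Conversely, a point in (a, b - delta] deposits its entire mass inside (a, b]. *)
Lemma crossings_le_density a b w : palm_zero pt w -> (0 <= a)%R ->
  weighted_crossings a (b - delta) w <= \int[leb]_(t in `]a, b]) (density (theta t w))%:E.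
Proof.
move=> w0 a0; rewrite density_cells//; apply: lee_nneseries => [n _ _|n _].
  exact: weight_ge0.
set x := pt n%:Z w; set m := Num.min _ _.
have m0 : (0 < m)%R by exact: (min_gap_gt0 hN).
have md : (m <= delta)%R by rewrite ge_min lexx orbT.
have r0 : (0 <= ratio n%:Z w)%R by exact: (gap_ratio_ge0 hN v0 hgv).
have rm : (ratio n%:Z w = ratio n%:Z w / m * m)%R by rewrite divfK// gt_eqF.
set q := (ratio n%:Z w / m)%R in rm *.
have q0 : (0 <= q)%R by rewrite divr_ge0// ltW.
rewrite indicE; case: (boolP (w \in _)); rewrite ?inE ?notin_setE/= /crossing/=
  -/x => xab; last first.
  by rewrite mulr0 mule_ge0// lee_fin.
rewrite mulr1 rm [leLHS]EFinM; apply: lee_wpmul2l; first by rewrite lee_fin.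
apply: (@le_trans _ _ (leb (`[x, (x + m)%R[%classic : set R))).
  by rewrite lebesgue_measure_itv/= lte_fin ltrDl m0 -EFinB addrAC subrr add0r.
apply: le_measure; rewrite ?inE; try exact: measurable_itv.
  by apply: measurableI; exact: measurable_itv.
move=> t tx; split => //; move: tx => /=; rewrite !in_itv/= => /andP[xt tx].
by case/andP: xab => ax xb; apply/andP; split; lra.
Qed.

Lemma measurable_density_section a b :
  measurable_fun setT (fun w => \int[leb]_(t in `]a, b]) (density (theta t w))%:E).
Proof.
apply: (@measurable_fun_section _ _ _ (fun w t => density (theta t w))).
  by apply/measurable_EFinP; apply: (measurable_flow_fun htheta);
    exact: (measurable_age_density hN v0 hgv delta0).
by move=> w t; exact: (age_density_ge0 hN v0 hgv delta0).
Qed.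

Lemma occupation_le_crossings a b : (0 <= a)%R ->
  occupation a b density <= crossings (a - delta) b.
Proof.
move=> a0; have dge0 := age_density_ge0 hN v0 hgv delta0.
have mY := measurable_age_density hN v0 hgv delta0.
rewrite (occupationE _ htheta)// -integral_weighted_crossings.
rewrite (integral_palm_zero hN hPalm (measurable_density_section a b)); last first.
  by move=> w; apply: integral_ge0 => t _; rewrite lee_fin.
rewrite (integral_palm_zero hN hPalm (measurable_weighted_crossings _ _)); last first.
  by move=> w; exact: weighted_crossings_ge0.
apply: ge0_le_integral.
- exact: (measurable_palm_zero hN).
- by move=> w _; apply: integral_ge0 => t _; rewrite lee_fin.
- exact/measurable_funTS/measurable_density_section.
- exact/measurable_funTS/measurable_weighted_crossings.
- by move=> w w0; exact: density_le_crossings.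
Qed.

Lemma crossings_le_occupation a b : (0 <= a)%R ->
  crossings a (b - delta) <= occupation a b density.
Proof.
move=> a0; have dge0 := age_density_ge0 hN v0 hgv delta0.
have mY := measurable_age_density hN v0 hgv delta0.
rewrite (occupationE _ htheta)// -integral_weighted_crossings.
rewrite [leRHS](integral_palm_zero hN hPalm (measurable_density_section a b)); last first.
  by move=> w; apply: integral_ge0 => t _; rewrite lee_fin.
rewrite (integral_palm_zero hN hPalm (measurable_weighted_crossings _ _)); last first.
  by move=> w; exact: weighted_crossings_ge0.
apply: ge0_le_integral.
- exact: (measurable_palm_zero hN).
- by move=> w _; exact: weighted_crossings_ge0.
- exact/measurable_funTS/measurable_weighted_crossings.
- exact/measurable_funTS/measurable_density_section.
- by move=> w w0; exact: crossings_le_density.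
Qed.

End Counting.

(** * Renewal limits *)

Section ElementaryRenewal.
Context {R : realType}.
Implicit Types (M : R -> R) (l : R).

(** Unit increments close to l telescope along a + n, and monotonicity interpolates between these
    times. *)
Lemma asymptotic_slope M l :
  (forall a b, 0 <= a -> a <= b -> M a <= M b) -> (forall a, 0 <= a -> 0 <= M a) ->
  0 <= l -> M (t + 1) - M t @[t --> +oo] --> l -> M t / t @[t --> +oo] --> l.
Proof.
move=> Mle M0 l0 /cvgrPdist_le Ml; apply/cvgrPdist_le => e e0.
have e2 : 0 < e / 2 by rewrite divr_gt0.
have [a1 [_ Ha1]] := Ml _ e2; pose a := Num.max 0 a1 + 1.
have aa1 : a1 < a by rewrite ltr_pwDr// le_max lexx orbT.
have a0 : 0 <= a by rewrite addr_ge0// le_max lexx.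
have H (n : nat) : `|M (a + n%:R) - M a - n%:R * l| <= n%:R * (e / 2).
  elim: n => [|n ih]; first by rewrite addr0 subrr !mul0r subr0 normr0.
  have an : a1 < a + n%:R by rewrite (lt_le_trans aa1)// lerDl.
  have /= := Ha1 _ an.
  rewrite -[n.+1%:R]natr1 addrA; move: ih; rewrite !ler_norml; lra.
(* Collects the terms that do not grow with t; they fall below e / 2 after division by t once t > C
   / (e / 2). *)
pose C := M a + l + e + l * (a + 1).
have C0 : 0 <= C.
  have la : 0 <= l * (a + 1) by apply: mulr_ge0 => //; lra.
  by have := M0 _ a0; rewrite /C; lra.
exists (Num.max (a + 1) (C / (e / 2))); split; first exact: num_real.
move=> t; rewrite gt_max => /andP[at' Ct].
have t0 : 0 < t by lra.
pose n := Num.truncn (t - a).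
have ta0 : 0 <= t - a by lra.
have [nt tn] : n%:R <= t - a /\ t - a < n%:R + 1.
  by rewrite natr1; split; [rewrite truncn_le|exact: truncnS_gt].
have M1 : M (a + n%:R) <= M t by apply: Mle; [exact: addr_ge0|rewrite -lerBrDl].
have M2 : M t <= M (a + n.+1%:R) by apply: (Mle _ _ (ltW t0)); rewrite -lerBlDl -natr1 ltW.
have Ma0 := M0 _ a0.
have bnd : `|l * t - M t| <= e / 2 * t + C.
  rewrite -[n.+1%:R]natr1 in M2.
  have := H n; have := H n.+1; rewrite -[n.+1%:R]natr1.
  have p1 : n%:R * l <= (t - a) * l by apply: ler_wpM2r.
  have p2 : (t - a) * l <= (n%:R + 1) * l by apply: ler_wpM2r => //; exact: ltW.
  have p3 : n%:R * (e / 2) <= t * (e / 2).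
    by apply: ler_wpM2r; [exact: ltW|apply: le_trans nt _; lra].
  have p4 : 0 <= l * a by exact: mulr_ge0.
  rewrite !ler_norml /C => /andP[h1 h2] /andP[h3 h4].
  move: n%:R h1 h2 h3 h4 p1 p2 p3 M1 M2 {nt tn} => k *; apply/andP; split; lra.
rewrite (_ : l - M t / t = (l * t - M t) / t); last by field; rewrite gt_eqF.
rewrite normrM normfV (gtr0_norm t0) ler_pdivrMr//; apply: (le_trans bnd).
move: Ct; rewrite ltr_pdivrMr//; lra.
Qed.

End ElementaryRenewal.

(** * Blackwell's limit for the mean count *)

Section Blackwell.
Context {d : measure_display} {Omega : measurableType d} {R : realType}.
Variables (theta : R -> Omega -> Omega) (pt : int -> Omega -> R)
  (P Pbar : probability Omega R).
Hypotheses (htheta : measurable_flow theta) (hN : simple_point_process pt)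
  (hshift : shift_compatible pt theta) (hPalm : palm_distribution pt theta P)
  (hPbar : stationary_distribution pt theta P Pbar)
  (hcount : forall t : R, 0 <= t -> (mean_count pt P t < +oo)%E).
Local Notation lambda := (intensity pt P).
Local Notation M := (fun t => fine (mean_count pt P t)).

Lemma mean_count_fin t : 0 <= t -> mean_count pt P t \is a fin_num.
Proof.
move=> t0; rewrite ge0_fin_numE ?hcount// mean_count_series//.
by apply: nneseries_ge0.
Qed.

Lemma mean_count_increment a b : 0 <= a -> a <= b ->
  crossings pt P a b = (M b - M a)%:E.
Proof.
move=> a0 ab; have b0 := le_trans a0 ab.
rewrite EFinB !fineK ?mean_count_fin//.
rewrite (mean_count_crossings P htheta hN hshift a0 ab).
by rewrite addeAC subee ?add0e ?mean_count_fin.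
Qed.

Variables (v : R) (gv : (nat -> R) -> R).
Hypotheses (v0 : 0 < v) (hgv : truncated_mean_version pt P v gv)
  (hui : uniformly_integrable P [set t : R | 0 <= t] (lambda_tilde pt gv))
  (hiii : forall (A : set Omega) (u : R), measurable A -> 0 <= u ->
    Pbar ((theta t @^-1` A) `&` [set w | pt 1 w <= u]) @[t --> +oo] -->
      (Pbar A * Pbar [set w | pt 1 w <= u]%R)%E).

Lemma blackwell h : 0 < h -> M (t + h) - M t @[t --> +oo] --> lambda * h.
Proof.
move=> h0; apply/cvgrPdist_le => e e0.
have l0 := intensity_gt0 hN hPbar.
have e2 : 0 < e / 2 by rewrite divr_gt0.
(* The count in (a, a + h] lies between the occupations of (a + delta, a + h] and (a, a + h +
   delta]. The bound h / 2 keeps the shorter window nonempty, and lambda delta <= e / 2 absorbs the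
   change of length. *)
pose delta := Num.min (h / 2) (e / 2 / lambda).
have d0 : 0 < delta by rewrite lt_min !divr_gt0.
have dh : delta < h by rewrite gt_min; apply/orP; left; lra.
have ld : lambda * delta <= e / 2.
  by rewrite mulrC -ler_pdivlMr// ge_min lexx orbT.
have hd0 : 0 < h + delta by rewrite addr_gt0.
have hd1 : 0 < h - delta by rewrite subr_gt0.
have [a1 H1] := age_density_upper htheta hN hshift hPalm hPbar v0 hgv d0 hui hiii hd0 e2.
have [a2 H2] := age_density_lower htheta hN hshift hPalm hPbar v0 hgv d0 hiii hd1 e2.
exists (Num.max 0 (Num.max a1 a2)); split; first exact: num_real.
move=> a; rewrite !gt_max => /and3P[a0 a1a a2a].
have ah : a <= a + h by rewrite lerDl ltW.
have := crossings_le_occupation htheta hN hshift hPalm v0 hgv d0 (a + (h + delta)) (ltW a0).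
move=> /le_trans/(_ (H1 a (ltW a1a))).
have ad0 : 0 <= a + delta by rewrite addr_ge0// ltW.
have := occupation_le_crossings htheta hN hshift hPalm v0 hgv d0 (a + delta + (h - delta)) ad0.
move=> /(le_trans (H2 (a + delta) _)).
rewrite (_ : a + delta + (h - delta) = a + h); last by ring.
rewrite (_ : a + (h + delta) - delta = a + h); last by ring.
rewrite addrK !mean_count_increment ?(ltW a0)// !lee_fin.
have -> : (a2 <= a + delta) by rewrite (le_trans (ltW a2a))// lerDl ltW.
move=> /(_ erefl) h1 h2; rewrite ler_norml; apply/andP; split; nra.
Qed.

End Blackwell.

Theorem corollary5p2 (R : realType) (d : measure_display)
  (Omega : measurableType d) (theta : R -> Omega -> Omega)
  (pt : int -> Omega -> R) (P Pbar : probability Omega R)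
  (g : R -> (nat -> R) -> R)
  (htheta : measurable_flow theta)
  (hN : simple_point_process pt)
  (hshift : shift_compatible pt theta)
  (hPalm : palm_distribution pt theta P)
  (hgap : forall n : int, P.-integrable setT (EFin \o gap pt n))
  (hPbar : stationary_distribution pt theta P Pbar)
  (hg : forall v : R, 0 < v -> truncated_mean_version pt P v (g v))
  (hcount : forall t : R, 0 <= t -> (mean_count pt P t < +oo)%E)
  (hi : stationary_sequence P (gap pt) /\ ergodic_sequence P (gap pt))
  (hii : exists v : R, 0 < v /\
    uniformly_integrable P [set t : R | 0 <= t] (lambda_tilde pt (g v)))
  (hiii : forall (A : set Omega) (u : R), measurable A -> 0 <= u ->
    Pbar ((theta t @^-1` A) `&` [set w | pt 1 w <= u]) @[t --> +oo] -->
      (Pbar A * Pbar [set w | pt 1 w <= u]%R)%E) :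
  [/\ fine (mean_count pt P t) / t @[t --> +oo] --> intensity pt P,
      forall h : R, 0 < h ->
        fine (mean_count pt P (t + h)) - fine (mean_count pt P t) @[t --> +oo]
          --> intensity pt P * h
    & forall v : R, 0 < v ->
        (intensity pt P)%:E =
          'E_Pbar[(fun w => lambda_tilde pt (g v) 0 w *
                            \1_[set w' | residual_time pt 0 w' <= v] w)%R]%E].
Proof.
have [v [v0 hui]] := hii.
have bw := blackwell htheta hN hshift hPalm hPbar hcount v0 (hg _ v0) hui hiii.
split=> //.
- apply: asymptotic_slope.
  + move=> a b a0 ab; rewrite -subr_ge0 -lee_fin -(mean_count_increment htheta hN)//.
    exact: crossings_ge0.
  + by move=> a a0; rewrite fine_ge0// mean_count_series//; exact: nneseries_ge0.
  + exact/ltW/(intensity_gt0 hN hPbar).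
  + by have := bw 1 ltr01; rewrite mulr1.
(* The cycle formula holds at every truncation level u; at time 0 the flow is the identity and the
   residual time is t_1. *)
- move=> u u0; rewrite -(stationary_residual htheta hN hshift hPalm hPbar u0 (hg _ u0)).
  rewrite unlock; apply: eq_integral => w _; rewrite (lambda_tilde_shift hN hshift).
  have [_ -> _] := htheta.
  congr ((_ * \1_(_) w)%:E); apply/seteqP.
  by split => w' /=; rewrite (residual_time0 hN).
Qed.
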